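(* Let $c$ be a positive integer and $\sigma^2>0$. Suppose that, for each $L$, $\boldsymbol{Z}=(Z_1,\dots,Z_L)$ and $\boldsymbol{X}=(X_1,\dots,X_L)$, where the $2L$ real random variables $Z_1,\dots,Z_L,X_1,\dots,X_L$ are i.i.d. and $$\frac{Z_1}{\sigma^2}\stackrel{d}{=}\frac{X_1}{\sigma^2}\sim\chi^2(c).$$ Define $$\hat\sigma_1^2(\boldsymbol{X})=\frac{\sum_{l=1}^L X_l}{cL},\qquad \hat\sigma_2^2(\boldsymbol{Z})=\sqrt{\frac{\sum_{l=1}^L (Z_l-\bar Z)^2}{2cL}},\qquad \bar Z=\frac1L\sum_{l=1}^L Z_l .$$ Then, as $L\to\infty$ (with $c$ and $\sigma^2$ fixed), $$\sqrt{\frac{cL}{2}}\left(\frac{\hat\sigma_2^2(\boldsymbol{Z})}{\hat\sigma_1^2(\boldsymbol{X})}-1\right)\xrightarrow{d}\mathcal N\left(0,\frac{c+10}{4}\right).$$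
   Context: $\chi^2(c)$ denotes the chi-square distribution with $c$ degrees of freedom; $\mathcal N(\mu,v)$ denotes the normal distribution with mean $\mu$ and variance $v$; $\stackrel{d}{=}$ denotes equality in distribution and $\xrightarrow{d}$ convergence in distribution. The symbols $\hat\sigma_1^2$ and $\hat\sigma_2^2$ are each a single name for the statistic defined by the displayed formula (both are estimators of $\sigma^2$); in particular $\hat\sigma_2^2(\boldsymbol{Z})$ itself equals the displayed square root. *)

(* Defs.v *)
From HB Require Import structures.
From mathcomp Require Export all_boot all_order all_algebra.
From mathcomp Require Export all_classical all_reals all_analysis.
Set Implicit Arguments.
Unset Strict Implicit.
Unset Printing Implicit Defensive.
Import Order.TTheory GRing.Theory Num.Theory.
Import numFieldNormedType.Exports.
Local Open Scope classical_set_scope.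
Local Open Scope ring_scope.

Section laws.
Context (d : measure_display) (T : measurableType d) (R : realType)
  (P : probability T R).

(* Equality is only required on measurable sets: off the sigma-algebra the
   values of a measure are irrelevant. *)
Definition has_law (Y : T -> R) (nu : set R -> \bar R) :=
  forall A : set R, measurable A -> P (Y @^-1` A) = nu A.

Definition mutually_independent (I : finType) (Y : I -> {RV P >-> R}) :=
  forall (J : {set I}) (A : I -> set R), (forall i, measurable (A i)) ->
    P (\bigcap_(i in [set` J]) (Y i @^-1` A i)) =
    (\prod_(i in J) P (Y i @^-1` A i))%E.

Definition identically_distributed (I : finType) (Y : I -> {RV P >-> R}) :=
  forall i j, has_law (Y i) (distribution P (Y j)).

Definition iid (I : finType) (Y : I -> {RV P >-> R}) :=
  mutually_independent Y /\ identically_distributed Y.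

(* The family (Z_1, ..., Z_L, X_1, ..., X_L). *)
Definition joint_family (L : nat) (Z X : 'I_L -> {RV P >-> R}) :
    'I_L + 'I_L -> {RV P >-> R} :=
  fun i => match i with inl l => Z l | inr l => X l end.

End laws.

Section chi_square.
Context {R : realType}.
Local Notation mu := (@lebesgue_measure R).

Definition gamma_fun (a : R) : R :=
  Rintegral mu `]0, +oo[ (fun x => x `^ (a - 1) * expR (- x)).

Definition chi2_pdf (c : nat) (x : R) : R :=
  if 0 < x then
    x `^ (c%:R / 2 - 1) * expR (- x / 2)
      / (2 `^ (c%:R / 2) * gamma_fun (c%:R / 2))
  else 0.

Definition chi2_prob (c : nat) (A : set R) : \bar R :=
  (\int[mu]_(x in A) (chi2_pdf c x)%:E)%E.

End chi_square.

(* [normal_prob] is parametrized by the standard deviation. *)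
Definition normal_law (R : realType) (m v : R) : set R -> \bar R :=
  normal_prob m (Num.sqrt v).

(* The random variables may live on different probability spaces. *)
Definition cvg_in_distribution (R : realType) (d : nat -> measure_display)
    (T : forall L, measurableType (d L)) (P : forall L, probability (T L) R)
    (Y : forall L, T L -> R) (nu : set R -> \bar R) :=
  (forall L, measurable_fun [set: T L] (Y L)) /\
  forall t : R, {for t, continuous (fun x : R => nu `]-oo, x]%classic)} ->
    P L (Y L @^-1` `]-oo, t]) @[L --> \oo] --> nu `]-oo, t]%classic.

Section estimators.
Context {R : realType} (c L : nat).
Implicit Types x z : 'I_L -> R.

Definition sample_mean z : R := (\sum_(l < L) z l) / L%:R.

(* Both statistics estimate sigma^2 itself, including the second one, which is
   the square root of a normalized sum of squares. *)
Definition sigmasq_hat1 x : R := (\sum_(l < L) x l) / (c%:R * L%:R).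

Definition sigmasq_hat2 z : R :=
  Num.sqrt ((\sum_(l < L) (z l - sample_mean z) ^+ 2) / (2 * c%:R * L%:R)).

End estimators.

(* Main.v *)
(** Put U = Z / sigma^2 - c and V = X / sigma^2 - c, which are centered. When the
    sums of the U_l and of the V_l are both at most K sqrt L, an event of
    probability at least 1 - 4 c / K^2 by Chebyshev, squaring shows that the
    statistic is at most t iff
      S = (sum (U_l^2 - 2 c) - 4 sum V_l) / (4 sqrt (2 c) sqrt L)
    is at most t up to an error O(1 / sqrt L), and S is a sum of 2 L independent
    centered variables of total variance (c + 10) / 4. The central limit theorem
    for S is obtained without characteristic functions, by Lindeberg replacement:
    expectations of a function of an independent sum are iterated averaging
    operators f |-> E f(. + xi), replacing one summand by a Gaussian with the same
    variance changes the result by at most the third absolute moments, and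
    Gaussian averaging operators form a semigroup. Logistic functions serve as
    smooth substitutes for the indicators of half-lines. *)
Require Import Defs.
From mathcomp Require Import all_boot all_order all_algebra.
From mathcomp Require Import all_classical all_reals all_analysis.
From mathcomp Require Import ring lra measurable_realfun.
Import Order.TTheory GRing.Theory Num.Theory.
Import numFieldNormedType.Exports.
Set Implicit Arguments.
Unset Strict Implicit.
Unset Printing Implicit Defensive.
Local Open Scope classical_set_scope.
Local Open Scope ring_scope.

(** * Averaging operators *)

Section bounded_measurable.
Context {R : realType}.

(** Comparing distribution functions at [t], rather than expanding the square root and the quotient,
    keeps the linearization exact: on the good event both sides of the inequality are nonnegative,
    so squaring is an equivalence, and the remainder is an explicit expression in the two normalized
    sums, bounded independently of L. The coefficient 4 of V arises there: squaring doubles the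
    relative error V / c of the first estimator, and the mean of U^2 is 2 c. The limit variance adds
    Var(U^2) = 8 c^2 + 48 c and Var(4 V) = 32 c, and divides by (4 sqrt (2 c))^2 = 32 c. Each of the
    2 L replacements costs third moments of order L^(-3/2), hence a total error of order 1 / sqrt L.
    Two choices shape the analysis. Smoothness is an expansion inequality, which can be integrated
    as it stands, so no derivative is taken under an integral. Integrals are manipulated for
    nonnegative integrands with values in the extended reals, so that finiteness of the moments is a
    conclusion and not a prerequisite. *)

Definition bounded_measurable (f : R -> R) :=
  measurable_fun setT f /\ exists K : R, forall x, `|f x| <= K.

Lemma bounded_measurable_integrable d (T : measurableType d)
    (P : probability T R) (f : R -> R) (g : T -> R) :
  bounded_measurable f -> measurable_fun setT g ->
  P.-integrable setT (EFin \o (f \o g)).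
Proof.
move=> [mf [K fK]] mg; apply: measurable_bounded_integrable => //.
- by apply: (le_lt_trans (probability_le1 _ _)) => //; rewrite ltry.
- exact: measurableT_comp.
- exists K; split; first exact: num_real.
  by move=> x Kx y _ /=; rewrite (le_trans (fK _))// ltW.
Qed.

Lemma Rintegral_cst_probability d (T : measurableType d)
    (P : probability T R) (r : R) : \int[P]_w r = r.
Proof.
rewrite Rintegral_cst//; have := congr1 (fun z => r * fine z) (probability_setT P).
by rewrite /= mulr1.
Qed.

Definition avg d (T : measurableType d) (P : probability T R) (xi : T -> R)
  (f : R -> R) (x : R) : R := \int[P]_w f (x + xi w).

Context d (T : measurableType d) (P : probability T R) (xi : T -> R).
Hypothesis mxi : measurable_fun setT xi.

Lemma integrable_shift f x : bounded_measurable f ->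
  P.-integrable setT (fun w => (f (x + xi w))%:E).
Proof.
move=> bf; apply: (@bounded_measurable_integrable _ _ _ f (fun w => x + xi w)) => //.
exact: measurable_funD.
Qed.

Lemma bounded_measurable_avg f :
  bounded_measurable f -> bounded_measurable (avg P xi f).
Proof.
move=> bf; have [mf [K fK]] := bf.
pose F (z : R * T) := (f (z.1 + xi z.2))%:E.
have mF : measurable_fun setT F.
  apply/measurable_EFinP; apply: measurableT_comp => //.
  by apply: measurable_funD => //; apply: measurableT_comp.
split.
(* Measurability in the parameter is extracted from Fubini, which asks for a measure on the
   parameter line too. A Dirac mass keeps the total mass at 1, so the bounded [F] is integrable. *)
- have iF : (\d_(0%R:R) \x P)%E.-integrable setT F.
    have Q1 : ((\d_(0%R:R) \x P) setT < +oo)%E.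
      rewrite -[X in (_ \x _)%E X]setXTT product_measure1E//.
      by rewrite [X in (_ * X)%E]probability_setT [X in (X * _)%E]diracT mule1 ltry.
    apply: (@measurable_bounded_integrable _ _ _ (\d_(0%R:R) \x P)%E
      (fun z : R * T => f (z.1 + xi z.2))) => //.
    + exact/measurable_EFinP.
    + exists K; split; first exact: num_real.
      by move=> x Kx y _ /=; rewrite (le_trans (fK _))// ltW.
  have := measurable_fubini_F iF.
  rewrite (_ : fubini_F _ _ = EFin \o avg P xi f); first by move/measurable_EFinP.
  apply/funext => x /=; rewrite /fubini_F /F /avg /Rintegral fineK//.
  apply: integrable_fin_num => //; exact: integrable_shift.
- exists K => x; rewrite (le_trans (le_normr_Rintegral _ _))//; first exact: integrable_shift.
  apply: (@le_trans _ _ (\int[P]_w K)).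
    apply: le_Rintegral => //.
      apply: integrable_norm; exact: integrable_shift.
    by apply: finite_measure_integrable_cst.
  by rewrite Rintegral_cst_probability.
Qed.

(** Contraction for the sup norm: an error made by one replacement is not amplified by the
    averagings that follow. *)
Lemma avg_contract (e : R) f g x : bounded_measurable f -> bounded_measurable g ->
  (forall x, `|f x - g x| <= e) -> `|avg P xi f x - avg P xi g x| <= e.
Proof.
move=> bf bg fg; rewrite /avg -RintegralB//; try exact: integrable_shift.
have ifg : P.-integrable setT (fun w => (f (x + xi w) - g (x + xi w))%:E).
  under eq_fun do rewrite EFinB.
  by apply: integrableB => //; exact: integrable_shift.
rewrite (le_trans (le_normr_Rintegral _ _))//.
apply: (@le_trans _ _ (\int[P]_w e)).
  apply: le_Rintegral => //; first exact: integrable_norm.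
  exact: finite_measure_integrable_cst.
by rewrite Rintegral_cst_probability.
Qed.

(* [a] and [b] stand for the first two derivatives of [f]: this is all of the
   smoothness that the replacement argument uses, and it is preserved by [avg]. *)
Definition smooth3 (M : R) (f : R -> R) := exists a b,
  [/\ bounded_measurable f, bounded_measurable a, bounded_measurable b &
   forall x h, `|f (x + h) - f x - a x * h - b x * (h ^+ 2 / 2)| <= M * `|h| ^+ 3].

Lemma smooth3_bounded_measurable (M : R) f : smooth3 M f -> bounded_measurable f.
Proof. by case=> a [b []]. Qed.

(** The expansion inequality is integrated pointwise in [w], with [a] and [b] averaged along. Total
    mass 1 leaves [M] unchanged, so one constant serves through the whole chain of operators. *)
Lemma smooth3_avg (M : R) f : smooth3 M f -> smooth3 M (avg P xi f).
Proof.
case=> a [b [bf ba bb H]]; exists (avg P xi a), (avg P xi b).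
split; try exact: bounded_measurable_avg.
move=> x h; rewrite /avg.
have ish y g : bounded_measurable g -> P.-integrable setT (fun w => (g (y + xi w))%:E).
  exact: integrable_shift.
rewrite -!RintegralZr//; try exact: ish.
have i1 : P.-integrable setT (fun w => (a (x + xi w) * h)%:E).
  under eq_fun do rewrite EFinM; apply: integrableZr => //; exact: ish.
have i2 : P.-integrable setT (fun w => (b (x + xi w) * (h ^+ 2 / 2))%:E).
  under eq_fun do rewrite EFinM; apply: integrableZr => //; exact: ish.
have i3 : P.-integrable setT (fun w => (f (x + h + xi w) - f (x + xi w))%:E).
  under eq_fun do rewrite EFinB; apply: integrableB => //; exact: ish.
have i4 : P.-integrable setT
   (fun w => (f (x + h + xi w) - f (x + xi w) - a (x + xi w) * h)%:E).
  by under eq_fun do rewrite EFinB; apply: integrableB.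
have i5 : P.-integrable setT
   (fun w => (f (x + h + xi w) - f (x + xi w) - a (x + xi w) * h
     - b (x + xi w) * (h ^+ 2 / 2))%:E).
  by under eq_fun do rewrite EFinB; apply: integrableB.
rewrite -RintegralB//; try exact: ish.
rewrite -RintegralB// -RintegralB//.
rewrite (le_trans (le_normr_Rintegral _ _))//.
apply: (@le_trans _ _ (\int[P]_w (M * `|h| ^+ 3))).
  apply: le_Rintegral => //; first exact: integrable_norm.
    exact: finite_measure_integrable_cst.
  by move=> w _; rewrite (addrAC x).
by rewrite Rintegral_cst_probability.
Qed.

(** Mean and variance are exact because they must cancel between a summand and its Gaussian
    substitute; the third absolute moment only enters an error term, so a bound suffices. *)
Definition moments3 (v rho : R) :=
  [/\ P.-integrable setT (EFin \o xi),
      P.-integrable setT (fun w => (xi w ^+ 2)%:E),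
      P.-integrable setT (fun w => (`|xi w| ^+ 3)%:E) &
   [/\ \int[P]_w xi w = 0, \int[P]_w (xi w ^+ 2) = v &
      \int[P]_w (`|xi w| ^+ 3) <= rho]].

(** The linear term integrates to 0, and what remains besides the error depends on [xi] only through
    its variance: two variables sharing [v] are therefore interchangeable. *)
Lemma avg_taylor (M : R) f a b v rho x : 0 <= M ->
  bounded_measurable f -> bounded_measurable a -> bounded_measurable b ->
  (forall x h, `|f (x + h) - f x - a x * h - b x * (h ^+ 2 / 2)| <= M * `|h| ^+ 3) ->
  moments3 v rho ->
  `|avg P xi f x - (f x + b x * (v / 2))| <= M * rho.
Proof.
move=> M0 bf ba bb H [i1 i2 i3 [e1 e2 e3]].
have j0 : P.-integrable setT (fun w => (f (x + xi w))%:E) by exact: integrable_shift.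
have j1 : P.-integrable setT (fun w => (a x * xi w)%:E).
  by under eq_fun do rewrite EFinM; apply: integrableZl.
have j2' : P.-integrable setT (fun w => (xi w ^+ 2 / 2)%:E).
  by under eq_fun do rewrite EFinM; apply: integrableZr.
have j2 : P.-integrable setT (fun w => (b x * (xi w ^+ 2 / 2))%:E).
  by under eq_fun do rewrite EFinM; apply: integrableZl.
have jc : P.-integrable setT (fun w => (f x)%:E).
  exact: finite_measure_integrable_cst.
have j3 : P.-integrable setT (fun w => (f (x + xi w) - f x)%:E).
  by under eq_fun do rewrite EFinB; apply: integrableB.
have j4 : P.-integrable setT (fun w => (f (x + xi w) - f x - a x * xi w)%:E).
  by under eq_fun do rewrite EFinB; apply: integrableB.
have j5 : P.-integrable setT (fun w =>
    (f (x + xi w) - f x - a x * xi w - b x * (xi w ^+ 2 / 2))%:E).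
  by under eq_fun do rewrite EFinB; apply: integrableB.
have j6 : P.-integrable setT (fun w => (M * `|xi w| ^+ 3)%:E).
  by under eq_fun do rewrite EFinM; apply: integrableZl.
rewrite (_ : _ - _ = \int[P]_w (f (x + xi w) - f x - a x * xi w - b x * (xi w ^+ 2 / 2))).
  rewrite (le_trans (le_normr_Rintegral _ _))//.
  apply: (@le_trans _ _ (\int[P]_w (M * `|xi w| ^+ 3))).
    by apply: le_Rintegral => //; exact: integrable_norm.
  by rewrite RintegralZl// ler_wpM2l.
rewrite !RintegralB//= !RintegralZl// RintegralZr// e1 e2.
by rewrite Rintegral_cst_probability /= /avg; ring.
Qed.

End bounded_measurable.

Section comparison.
Context {R : realType}.
Context d (T : measurableType d) (P : probability T R).
Context d' (T' : measurableType d').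

Lemma avg_compare (Q : probability T' R) (M : R) f (xi : T -> R) (xi' : T' -> R)
    v rho rho' (x : R) :
  measurable_fun setT xi -> measurable_fun setT xi' -> 0 <= M -> smooth3 M f ->
  moments3 P xi v rho -> moments3 Q xi' v rho' ->
  `|avg P xi f x - avg Q xi' f x| <= M * (rho + rho').
Proof.
move=> mxi mxi' M0 [a [b [bf ba bb H]]] m m'.
have := avg_taylor mxi x M0 bf ba bb H m.
have := avg_taylor mxi' x M0 bf ba bb H m'.
rewrite !ler_norml => /andP[h1 h2] /andP[h3 h4].
apply/andP; split; lra.
Qed.

Lemma foldl_avg_contract (I : eqType) (s : seq I) (xi : I -> T -> R) (e : R) f g x :
  (forall i, measurable_fun setT (xi i)) ->
  bounded_measurable f -> bounded_measurable g -> (forall x, `|f x - g x| <= e) ->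
  `|foldl (fun f i => avg P (xi i) f) f s x - foldl (fun f i => avg P (xi i) f) g s x|
   <= e.
Proof.
move=> mxi; elim: s f g x => [|i s IH] f g x bf bg fg //=.
by apply: IH; [exact: bounded_measurable_avg..|move=> y; exact: avg_contract].
Qed.

(** Telescoping. The hybrid [B] uses the substitute for the first operator and the original ones
    afterwards: [A - B] is a single replacement pushed through contractions, and [B - C] is the
    induction hypothesis for the averaged function, which is still [smooth3 M]. *)
Lemma foldl_avg_compare (I : eqType) (s : seq I) (xi : I -> T -> R)
    (Q : I -> probability T' R) (xi' : I -> T' -> R) (v rho rho' : I -> R) (M : R) f x :
  (forall i, measurable_fun setT (xi i)) -> (forall i, measurable_fun setT (xi' i)) ->
  0 <= M -> smooth3 M f ->
  (forall i, moments3 P (xi i) (v i) (rho i)) ->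
  (forall i, moments3 (Q i) (xi' i) (v i) (rho' i)) ->
  `|foldl (fun f i => avg P (xi i) f) f s x - foldl (fun f i => avg (Q i) (xi' i) f) f s x|
   <= M * \sum_(i <- s) (rho i + rho' i).
Proof.
move=> mxi mxi' M0 sf m m'.
elim: s f sf x => [|i s IH] f sf x.
  by rewrite big_nil /= mulr0 subrr normr0.
rewrite big_cons mulrDr /=.
set A := foldl _ (avg P _ _) _ _; set C := foldl _ _ _ _.
pose B := foldl (fun f i => avg P (xi i) f) (avg (Q i) (xi' i) f) s x.
have -> : A - C = (A - B) + (B - C) by ring.
have bfP : bounded_measurable f := smooth3_bounded_measurable sf.
rewrite (le_trans (ler_normD _ _))// lerD//.
- apply: foldl_avg_contract => //; [exact: bounded_measurable_avg..|move=> y].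
  exact: avg_compare (m i) (m' i).
- apply: IH => //; exact: smooth3_avg.
Qed.

End comparison.

(** * Soft step functions *)

Section logistic.
Context {R : realType}.

(** Decreasing from 1 to 0, the mirror image of the usual sigmoid, because the indicators to be
    smoothed are those of the half-lines []-oo, t]]. *)
Definition logistic (x : R) : R := (1 + expR x)^-1.

Lemma logistic_gt0 x : 0 < logistic x.
Proof. by rewrite invr_gt0 addr_gt0// expR_gt0. Qed.

Lemma logistic_lt1 x : logistic x < 1.
Proof. by rewrite invf_lt1 ?ltrDl ?expR_gt0// addr_gt0// expR_gt0. Qed.

Lemma is_derive_logistic (x : R) :
  is_derive x 1 logistic (logistic x ^+ 2 - logistic x).
Proof.
have e0 : 1 + expR x != 0 by rewrite gt_eqF// addr_gt0// expR_gt0.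
have H : is_derive x 1 (fun y : R => 1 + expR y) (expR x).
  by apply: (is_derive_eq (is_deriveD (is_derive_cst _ _ _) (is_derive_expR x))); rewrite add0r.
rewrite /logistic.
refine (is_derive_eq (@is_deriveV _ (fun y : R => 1 + expR y) x _ 1 e0 H) _).
by rewrite /GRing.scale /=; field.
Qed.

Lemma is_derive_affine (k m x : R) : is_derive x 1 (fun y : R => k * (y - m)) k.
Proof.
apply: (is_derive_eq (is_deriveM (is_derive_cst k x 1)
  (is_deriveB (is_derive_id x 1) (is_derive_cst m x 1)))).
by rewrite subr0 /GRing.scale /= mulr1 mulr0 addr0.
Qed.

(** The mean value theorem writes [u t] as [t] times [du] at a point between 0 and [t]. The factor 1
    / (n + 1) that integration would gain is given up. *)
Lemma is_derive_bound_growth (u du : R -> R) (M : R) n :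
  (forall t : R, is_derive t 1 u (du t)) -> u 0 = 0 ->
  (forall t, `|du t| <= M * `|t| ^+ n) -> forall t, `|u t| <= M * `|t| ^+ n.+1.
Proof.
move=> Hu u0 Hdu t.
have M0 : 0 <= M.
  by have := Hdu 1; rewrite normr1 expr1n mulr1; apply: le_trans.
have cu : continuous u.
  by move=> z; apply: differentiable_continuous; apply/derivable1_diffP; case: (Hu z).
have [t0|t0] := leP 0 t.
- have [c /[!in_itv]/= /andP[c0 ct]] := MVT_segment t0 (fun x _ => Hu x)
    (@continuous_subspaceT _ _ _ _ cu).
  rewrite u0 !subr0 => ->; rewrite normrM exprSr mulrA ler_wpM2r//.
  by rewrite (le_trans (Hdu c))// ler_wpM2l// lerXn2r ?nnegrE// !ger0_norm.
- have [c /[!in_itv]/= /andP[ct c0]] := MVT_segment (ltW t0) (fun x _ => Hu x)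
    (@continuous_subspaceT _ _ _ _ cu).
  rewrite u0 !sub0r => e; rewrite -normrN e normrM normrN exprSr mulrA ler_wpM2r//.
  by rewrite (le_trans (Hdu c))// ler_wpM2l// lerXn2r ?nnegrE// !ler0_norm ?lerN2// ltW.
Qed.

Lemma is_derive_translate (g dg : R -> R) (x t : R) :
  (forall y : R, is_derive y 1 g (dg y)) ->
  is_derive t 1 (fun t => g (x + t)) (dg (x + t)).
Proof.
move=> Hg.
have H : is_derive t 1 (fun t : R => x + t) 1.
  by apply: (is_derive_eq (is_deriveD (is_derive_cst x t 1) (is_derive_id t 1))); rewrite add0r.
by apply: (is_derive_eq (@is_derive1_comp _ _ _ t _ _ (Hg (x + t)) H)); rewrite mulr1.
Qed.

(** The growth lemma is applied to the remainders of [g2], [g1] and [g] in turn, each being the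
    derivative of the next; hence the constant [M] instead of M / 6. *)
Lemma taylor3 (g g1 g2 g3 : R -> R) (M : R) :
  (forall y : R, is_derive y 1 g (g1 y)) -> (forall y : R, is_derive y 1 g1 (g2 y)) ->
  (forall y : R, is_derive y 1 g2 (g3 y)) -> (forall y, `|g3 y| <= M) ->
  forall x h, `|g (x + h) - g x - g1 x * h - g2 x * (h ^+ 2 / 2)| <= M * `|h| ^+ 3.
Proof.
move=> H0 H1 H2 HM x.
have T0 := is_derive_translate x _ H0.
have T1 := is_derive_translate x _ H1.
have T2 := is_derive_translate x _ H2.
have lin c (t : R) : is_derive t 1 (fun t : R => c * t) c.
  apply: (is_derive_eq (is_deriveM (is_derive_cst c t 1) (is_derive_id t 1))).
  by rewrite /GRing.scale /= mulr1 mulr0 addr0.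
have quad c (t : R) : is_derive t 1 (fun t : R => c * (t ^+ 2 / 2)) (c * t).
  by apply: (is_derive_eq (is_deriveM (is_derive_cst c t 1)
    (is_deriveM (is_deriveX 2 (is_derive_id t 1)) (is_derive_cst (2^-1 : R) t 1))));
    rewrite /GRing.scale /= /cst; field.
have S2 t : `|g2 (x + t) - g2 x| <= M * `|t| ^+ 1.
  apply: (@is_derive_bound_growth (fun t => g2 (x + t) - g2 x) (fun t => g3 (x + t))).
  - move=> s; by apply: (is_derive_eq (is_deriveB (T2 s) (is_derive_cst (g2 x) s 1)));
    rewrite subr0.
  - by rewrite addr0 subrr.
  - by move=> s; rewrite expr0 mulr1.
have S1 t : `|g1 (x + t) - g1 x - g2 x * t| <= M * `|t| ^+ 2.
  apply: (@is_derive_bound_growth (fun t => g1 (x + t) - g1 x - g2 x * t)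
     (fun t => g2 (x + t) - g2 x)) => //.
  - move=> s; by apply: (is_derive_eq (is_deriveB (is_deriveB (T1 s)
      (is_derive_cst (g1 x) s 1)) (lin (g2 x) s))); rewrite subr0.
  - by rewrite addr0 subrr mulr0 subr0.
apply: (@is_derive_bound_growth (fun h => g (x + h) - g x - g1 x * h - g2 x * (h ^+ 2 / 2))
     (fun t => g1 (x + t) - g1 x - g2 x * t)) => //.
- move=> s; by apply: (is_derive_eq (is_deriveB (is_deriveB (is_deriveB (T0 s)
    (is_derive_cst (g x) s 1))
    (lin (g1 x) s)) (quad (g2 x) s))); rewrite subr0.
- by rewrite addr0 subrr mulr0 expr0n /= mul0r mulr0 !subr0.
Qed.

Definition soft_step (k m x : R) : R := logistic (k * (x - m)).

Lemma soft_step_ge0 k m x : 0 <= soft_step k m x.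
Proof. exact/ltW/logistic_gt0. Qed.

Lemma soft_step_le1 k m x : soft_step k m x <= 1.
Proof. exact/ltW/logistic_lt1. Qed.

Lemma continuous_bounded_measurable (f : R -> R) (K : R) :
  continuous f -> (forall x, `|f x| <= K) -> bounded_measurable f.
Proof. by move=> cf fK; split; [exact: continuous_measurable_fun|exists K]. Qed.

(** The equation q' = k (q^2 - q) makes every derivative a polynomial in q times a power of [k];
    since q lies in [0, 1], bounding these polynomials there by 1 gives the successive bounds k,
    k^2, k^3. *)
Lemma smooth3_soft_step (k m : R) : 0 < k -> smooth3 (k ^+ 3) (soft_step k m).
Proof.
move=> k0.
pose q := soft_step k m.
have Hq (x : R) : is_derive x 1 q (k * (q x ^+ 2 - q x)).
  by apply: (is_derive_eq (@is_derive1_comp _ logistic _ x _ _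
    (is_derive_logistic _) (is_derive_affine k m x))); rewrite mulrC.
pose q1 x := k * (q x ^+ 2 - q x).
pose q2 x := k * (2 * q x - 1) * q1 x.
pose q3 x := k ^+ 2 * (6 * q x ^+ 2 - 6 * q x + 1) * q1 x.
have Hq1 (x : R) : is_derive x 1 q1 (q2 x).
  by apply: (is_derive_eq (is_deriveM (is_derive_cst k x 1)
    (is_deriveB (is_deriveX 2 (Hq x)) (Hq x))));
    rewrite /q2 /q1 /GRing.scale /=; ring.
have Hq2 (x : R) : is_derive x 1 q2 (q3 x).
  by apply: (is_derive_eq (is_deriveM (is_deriveM (is_derive_cst k x 1)
     (is_deriveB (is_deriveM (is_derive_cst (2:R) x 1) (Hq x)) (is_derive_cst (1:R) x 1)))
     (Hq1 x)));
    rewrite /q3 /q2 /q1 /GRing.scale /= !fctE /=; ring.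
have ctn (f df : R -> R) : (forall x : R, is_derive x 1 f (df x)) -> continuous f.
  move=> Hf z; apply: differentiable_continuous; apply/derivable1_diffP.
  by case: (Hf z).
have q01 x : 0 <= q x <= 1 by rewrite /q soft_step_ge0 soft_step_le1.
have q1b x : `|q1 x| <= k.
  rewrite /q1 normrM gtr0_norm// ler_piMr ?(ltW k0)//.
  by rewrite ler_norml; apply/andP; split; have := q01 x; nra.
have q2b x : `|q2 x| <= k * k.
  rewrite /q2 normrM ler_pM// normrM gtr0_norm// ler_piMr ?(ltW k0)//.
  by rewrite ler_norml; apply/andP; split; have := q01 x; lra.
have q3b x : `|q3 x| <= k ^+ 3.
  rewrite /q3 normrM [leRHS]exprSr ler_pM// normrM gtr0_norm ?exprn_gt0//.
  rewrite ler_piMr ?exprn_ge0 ?(ltW k0)//.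
  by rewrite ler_norml; apply/andP; split; have := q01 x; nra.
exists q1, q2; split.
- apply: (@continuous_bounded_measurable _ 1); first exact: ctn Hq.
  by move=> x; rewrite ger0_norm ?soft_step_ge0// soft_step_le1.
- exact: (continuous_bounded_measurable (ctn _ _ Hq1) q1b).
- exact: (continuous_bounded_measurable (ctn _ _ Hq2) q2b).
- exact: (taylor3 Hq Hq1 Hq2 q3b).
Qed.

Lemma soft_step_approx (e d m : R) : 0 < e -> 0 < d ->
  exists2 k : R, 0 < k & (forall x : R, x <= m - d -> 1 - e <= soft_step k m x) /\
    (forall x : R, m + d <= x -> soft_step k m x <= e).
Proof.
(* At distance [d] from [m] the slope 1 / (d e) brings the argument to 1 / e, where exp y >= 1 + y
   gives [logistic y <= e]. The other side follows from the symmetry [refl]. *)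
move=> e0 d0; have de0 : 0 < (d * e)^-1 by rewrite invr_gt0 mulr_gt0.
exists (d * e)^-1 => //.
have large y : e^-1 <= y -> logistic y <= e.
  move=> ey; rewrite /logistic -[leRHS]invrK lef_pV2 ?posrE ?invr_gt0 ?addr_gt0 ?expR_gt0//.
  by have := expR_ge1Dx y; lra.
have refl y : logistic y = 1 - logistic (- y).
  rewrite /logistic expRN; have := expR_gt0 y => p.
  by field; rewrite !gt_eqF// addr_gt0.
have eV : e^-1 = (d * e)^-1 * d by field; rewrite !gt_eqF.
split=> x hx; rewrite /soft_step.
- rewrite refl lerD2l lerN2 large// -mulrN eV ler_pM2l//; lra.
- rewrite large// eV ler_pM2l//; lra.
Qed.

End logistic.

(** * Densities and integration by parts *)

Section integrals.
Context {R : realType}.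
Local Notation mu := (@lebesgue_measure R).

(** For increments of size at most 1 the quadratic and cubic terms are dominated by the linear one,
    so [f] is Lipschitz around [x]. Continuity is what the change of variable in [gauss_avg_kernel]
    asks for. *)
Lemma smooth3_continuous (M : R) f : smooth3 M f -> continuous f.
Proof.
move=> [a [b [_ _ _ H]]] x.
pose K := `|a x| + `|b x| + `|M|.
have K0 : 0 <= K by rewrite !addr_ge0.
have bound h : `|h| <= 1 -> `|f (x + h) - f x| <= K * `|h|.
  move=> h1; have := H x h; set A := (a x * h); set B := b x * _ => HH.
  have -> : f (x + h) - f x = (f (x + h) - f x - A - B) + (A + B) by ring.
  rewrite (le_trans (ler_normD _ _))//.
  have hA : `|A| <= `|a x| * `|h| by rewrite /A normrM.
  have hh : `|h| ^+ 2 <= `|h| by rewrite expr2 ler_piMr.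
  have hB : `|B| <= `|b x| * `|h|.
    rewrite /B normrM ler_wpM2l// normrM normrX (le_trans _ hh)//.
    by rewrite ler_piMr ?exprn_ge0// ger0_norm ?invr_ge0//; lra.
  have hM : `|f (x + h) - f x - A - B| <= `|M| * `|h|.
    apply: (le_trans HH); apply: (@le_trans _ _ (`|M| * `|h| ^+ 3)).
      by rewrite ler_wpM2r ?exprn_ge0// ler_norm.
    rewrite ler_wpM2l//; apply: le_trans hh.
    by rewrite exprSr ler_piMr ?exprn_ge0.
  have := ler_normD A B; rewrite /K !mulrDl; lra.
apply/(@cvgrPdist_le _ R^o) => e e0.
near=> y.
have y1 : `|y - x| <= 1.
  by near: y; apply/nbhs_ballP; exists 1 => //= z; rewrite /ball /= distrC => /ltW.
have ye : `|y - x| <= e / (K + 1).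
  near: y; apply/nbhs_ballP; exists (e / (K + 1)) => /=.
    by rewrite divr_gt0// ltr_wpDl.
  by move=> z; rewrite /ball /= distrC => /ltW.
have := bound _ y1; rewrite addrCA subrr addr0 distrC => /le_trans; apply.
rewrite (@le_trans _ _ ((K + 1) * (e / (K + 1))))//; last first.
  by rewrite mulrC divfK// gt_eqF// ltr_wpDl.
by rewrite ler_pM// lerDl.
Unshelve. all: by end_near.
Qed.

Import HBNNSimple.

(** The hypothesis is the case of indicators; it extends to simple functions by linearity, then to
    [g] by monotone convergence on both sides. *)
Lemma ge0_integral_density d (T : measurableType d) (P : {measure set T -> \bar R})
    (X : T -> R) (p g : R -> R) :
  measurable_fun setT X -> measurable_fun setT p -> (forall x, 0 <= p x) ->
  (forall A, measurable A -> P (X @^-1` A) = \int[mu]_(x in A) (p x)%:E)%E ->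
  measurable_fun setT g -> (forall x, 0 <= g x) ->
  (\int[P]_w (g (X w))%:E = \int[mu]_x (g x * p x)%:E)%E.
Proof.
move=> mX mp p0 PE mg g0.
have simple (h : {nnsfun R >-> R}) :
    (\int[P]_w (h (X w))%:E = \int[mu]_x (h x * p x)%:E)%E.
  have mhr r : measurable (h @^-1` [set r]) by exact: measurable_sfunP.
  have miX r : measurable_fun setT (fun w : T => (\1_(X @^-1` (h @^-1` [set r])) w : R)%:E).
    apply/measurable_EFinP/measurable_indic.
    by rewrite -[X in measurable X]setTI; exact: mX.
  have mi r : measurable_fun setT (fun x : R => (\1_(h @^-1` [set r]) x : R)%:E).
    exact/measurable_EFinP/measurable_indic.
  have mip r : measurable_fun setT (fun x : R => (\1_(h @^-1` [set r]) x * p x)%:E).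
    apply/measurable_EFinP; apply: measurable_funM => //; exact: measurable_indic.
  have hX w : (h (X w))%:E = (\sum_(r \in range h) (r * \1_(X @^-1` (h @^-1` [set r])) w)%:E)%E.
    by rewrite fimfunE -fsumEFin.
  have hp x : (h x * p x)%:E =
      (\sum_(r \in range h) (r%:E * (\1_(h @^-1` [set r]) x * p x)%:E))%E.
    rewrite EFinM fimfunE -fsumEFin// ge0_mule_fsuml; last first.
      by move=> r; rewrite EFinM nnfun_muleindic_ge0.
    by apply: eq_fsbigr => r _; rewrite !EFinM muleA.
  have ge0 r w : (0 <= (r * \1_(X @^-1` (h @^-1` [set r])) w)%:E)%E.
    exact: (nnfun_muleindic_ge0 h r (X w)).
  have ge0' r x : (0 <= r%:E * (\1_(h @^-1` [set r]) x * p x)%:E)%E.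
    rewrite EFinM muleA; apply: mule_ge0; last by rewrite lee_fin.
    exact: nnfun_muleindic_ge0.
  under eq_integral do rewrite hX.
  under [RHS]eq_integral do rewrite hp.
  rewrite ge0_integral_fsum//; last first.
    by move=> r; under eq_fun do rewrite EFinM; exact: measurable_funeM.
  have mrip r : measurable_fun setT (fun x : R => (r%:E * (\1_(h @^-1` [set r]) x * p x)%:E)%E).
    exact: measurable_funeM.
  rewrite [RHS]ge0_integral_fsum//.
  apply: eq_fsbigr => r _.
  (* A nonnegative simple function has no negative value, so these terms vanish; for the others
     [0 <= r] allows the constant to leave the integral. *)
  have [r0|r0] := ltP r 0.
    rewrite preimage_nnfun0// preimage_set0 !integral0_eq// => x _.
      by rewrite indic0 mul0r mule0.
    by rewrite indic0 mulr0.
  under eq_integral do rewrite EFinM.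
  have ge2 x : (0 <= (\1_(h @^-1` [set r]) x * p x)%:E)%E by rewrite lee_fin mulr_ge0.
  rewrite ge0_integralZl// [RHS]ge0_integralZl//; last exact: mip.
  congr (_ * _)%E.
  rewrite integral_indic//; last by rewrite -[X in measurable X]setTI; exact: mX.
  rewrite setIT PE// [LHS]integral_mkcond [RHS]integral_mkcond.
  apply: eq_integral => x _; rewrite !patchE indicE in_setT.
  by case: ifPn => _; rewrite ?mul1r ?mul0r.
have mEg : measurable_fun setT (EFin \o g) by exact/measurable_EFinP.
pose h := nnsfun_approx measurableT mEg.
have hcvg x : (EFin \o h^~ x) @ \oo --> (g x)%:E.
  by apply: (cvg_nnsfun_approx (D := setT)) => // y _; rewrite lee_fin.
have nd x : {homo (fun n => h n x) : n m / (n <= m)%N >-> n <= m}.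
  by move=> m n mn; exact/lefP/nd_nnsfun_approx.
have mhp n : measurable_fun setT (fun x : R => (h n x * p x)%:E).
  by apply/measurable_EFinP; apply: measurable_funM.
transitivity (lim (\int[P]_w (h n (X w))%:E @[n --> \oo])%E).
  rewrite -monotone_convergence//=.
  - by apply: eq_integral => x _; apply/esym/cvg_lim => //; exact: hcvg.
  - by move=> n; apply/measurable_EFinP; exact: measurableT_comp.
  - by move=> n x _; rewrite lee_fin.
  - by move=> x _ m n mn; rewrite lee_fin nd.
transitivity (lim (\int[mu]_x (h n x * p x)%:E @[n --> \oo])%E).
  by apply: congr_lim; apply/funext => n; exact: simple.
rewrite -monotone_convergence//=.
- apply: eq_integral => x _; apply/cvg_lim => //.
  under eq_fun do rewrite EFinM; rewrite EFinM.
  by apply: cvgeZr => //; exact: hcvg.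
- by move=> n x _; rewrite lee_fin mulr_ge0.
- by move=> x _ m n mn; rewrite lee_fin ler_wpM2r// nd.
Qed.

(** On each segment the integrals of [f] and [g] differ by the increment of [F]. Nonnegativity makes
    both converge monotonically along the exhaustion, so the equality also covers infinite values
    and yields moment recursions before any integrability is known. *)
Lemma integral_parts_exhaust (F f g : R -> R) (al be : nat -> R) :
  (forall n, al n < be n) ->
  {homo al : m n / (m <= n)%N >-> n <= m} -> {homo be : m n / (m <= n)%N >-> m <= n} ->
  (forall n x, al n <= x <= be n -> [/\ is_derive x (1:R) F (f x - g x),
     {for x, continuous f}, {for x, continuous g}, 0 <= f x & 0 <= g x]) ->
  F (be n) - F (al n) @[n --> \oo] --> (0:R) ->
  (\int[mu]_(x in \bigcup_n `[al n, be n]%classic) (f x)%:E =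
   \int[mu]_(x in \bigcup_n `[al n, be n]%classic) (g x)%:E)%E.
Proof.
move=> ab nal nbe H Fcvg.
have inI n x : `[al n, be n]%classic x -> al n <= x <= be n by rewrite /= in_itv.
have wc (h : R -> R) n : (forall x, al n <= x <= be n -> {for x, continuous h}) ->
    {within `[al n, be n], continuous h}.
  move=> ch; apply: continuous_in_subspaceT => x.
  by rewrite inE => /inI; exact: ch.
have wcf n : {within `[al n, be n], continuous f} by apply: wc => x /H [].
have wcg n : {within `[al n, be n], continuous g} by apply: wc => x /H [].
have intg (h : R -> R) n : {within `[al n, be n], continuous h} ->
    mu.-integrable `[al n, be n] (EFin \o h).
  by move=> ch; apply: continuous_compact_integrable => //; exact: segment_compact.
have mI (h : R -> R) n : {within `[al n, be n], continuous h} ->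
    measurable_fun `[al n, be n] (EFin \o h).
  by move=> /intg /measurable_int.
have ndI : nondecreasing_seq (fun n => `[al n, be n]%classic).
  move=> m n mn; apply/subsetPset => x /inI /andP[h1 h2] /=.
  by rewrite in_itv/= (le_trans (nal _ _ mn) h1) (le_trans h2 (nbe _ _ mn)).
have cvgI (h : R -> R) : (forall n, {within `[al n, be n], continuous h}) ->
    (forall n x, al n <= x <= be n -> 0 <= h x) ->
    (\int[mu]_(x in `[al n, be n]) (h x)%:E)%E @[n --> \oo] -->
    (\int[mu]_(x in \bigcup_n `[al n, be n]%classic) (h x)%:E)%E.
  move=> ch h0; apply: ge0_nondecreasing_set_cvg_integral => //.
  by move=> n; exact: (mI h n (ch n)).
have cf := cvgI f wcf (fun n x hx => let: And5 _ _ _ f0 _ := H n x hx in f0).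
have cg := cvgI g wcg (fun n x hx => let: And5 _ _ _ _ g0 := H n x hx in g0).
have E n : (\int[mu]_(x in `[al n, be n]) (f x)%:E =
    \int[mu]_(x in `[al n, be n]) (g x)%:E + (F (be n) - F (al n))%:E)%E.
  have dF x : al n <= x <= be n -> is_derive x (1:R) F (f x - g x) by move=> /H [].
  have cF x : al n <= x <= be n -> {for x, continuous F}.
    by move=> /dF [dFx _]; apply: differentiable_continuous; exact/derivable1_diffP.
  have := @continuous_FTC2 R (fun x => f x - g x) F (al n) (be n) (ab n).
  rewrite EFinB => <-.
  - rewrite [X in (_ + X)%E](integralB_EFin _ (intg f n (wcf n)) (intg g n (wcg n)))//.
    rewrite addeC subeK//; apply: integrable_fin_num => //; exact: intg.
  - by move=> x; apply: continuousB; [exact: wcf|exact: wcg].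
  - split.
    + by move=> x; rewrite in_itv/= => /andP[/ltW h1 /ltW h2]; case: (dF x) => //; rewrite h1.
    + by apply: cvg_at_right_filter; apply: cF; rewrite lexx ltW.
    + by apply: cvg_at_left_filter; apply: cF; rewrite lexx ltW.
  - move=> x; rewrite in_itv/= => /andP[/ltW h1 /ltW h2].
    by rewrite derive1E; case: (dF x) => //; rewrite h1.
have cg' : (\int[mu]_(x in `[al n, be n]) (f x)%:E)%E @[n --> \oo] -->
    (\int[mu]_(x in \bigcup_n `[al n, be n]%classic) (g x)%:E + 0)%E.
  under eq_fun do rewrite E.
  apply: cvgeD => //; first by rewrite fin_num_adde_defl.
  by apply: cvg_EFin => //; near=> n.
by rewrite adde0 in cg'; exact: (cvg_unique _ cf cg').
Unshelve. all: by end_near.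
Qed.

(** A single term of the exponential series, the one of degree m + 1, already beats x^m by a factor
    x. *)
Lemma powX_expRN_bound (m : nat) (a x : R) : 0 < a -> 0 < x ->
  x ^+ m * expR (- (a * x)) <= m.+1`!%:R / a ^+ m.+1 * x^-1.
Proof.
move=> a0 x0.
have := expR_ge1Dxn m (ltW (mulr_gt0 a0 x0)) => h.
rewrite expRN ler_pdivrMr ?expR_gt0//.
rewrite (@le_trans _ _ (m.+1`!%:R / a ^+ m.+1 / x * ((a * x) ^+ m.+1 / m.+1`!%:R)))//.
  rewrite exprMn [x ^+ m.+1]exprSr le_eqVlt; apply/orP; left; apply/eqP.
  have f0 : m.+1`!%:R != 0 :> R by rewrite pnatr_eq0 -lt0n fact_gt0.
  have am0 : a ^+ m.+1 != 0 by rewrite gt_eqF// exprn_gt0.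
  have x0' : x != 0 by rewrite gt_eqF.
  move: (m.+1`!%:R) (a ^+ m.+1) (x ^+ m) f0 am0 => f am xm f0 am0.
  by field; rewrite f0 am0 x0'.
rewrite ler_wpM2l//; last by rewrite (le_trans _ h)// lerDr.
by rewrite !mulr_ge0 ?invr_ge0 ?exprn_ge0 ?ltW.
Qed.

Lemma cvg_powX_expRN (m : nat) (a : R) : 0 < a ->
  n.+1%:R ^+ m * expR (- (a * n.+1%:R)) @[n --> \oo] --> (0:R).
Proof.
move=> a0.
apply: (@squeeze_cvgr _ _ _ _ (cst 0) (fun n => m.+1`!%:R / a ^+ m.+1 * n.+1%:R^-1)).
- near=> n; rewrite mulr_ge0 ?expR_ge0 ?exprn_ge0//=.
  exact: powX_expRN_bound.
- exact: cvg_cst.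
- rewrite -[X in _ --> X](mulr0 (m.+1`!%:R / a ^+ m.+1)).
  by apply: cvgMr; exact: cvg_harmonic.
Unshelve. all: by end_near.
Qed.

End integrals.

(** * Independent sums *)

Section independence.
Context d (T : measurableType d) (R : realType) (P : probability T R).

Lemma measurable_preimage (X : T -> R) A : measurable_fun setT X -> measurable A ->
  measurable (X @^-1` A).
Proof. by move=> mX mA; rewrite -[X in measurable X]setTI; exact: mX. Qed.

(** Both sides are finite measures in [C] (the law of the pair under [P] restricted to [D], and a
    multiple of its law under [P]) that agree on rectangles, a generating class closed under
    intersection. This is needed because the event that a sum lies in [B] is not a rectangle. *)
Lemma pair_event_product (X Y : T -> R) (D : set T) :
  measurable_fun setT X -> measurable_fun setT Y -> measurable D ->
  (forall A B, measurable A -> measurable B ->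
     (P (X @^-1` A `&` Y @^-1` B `&` D) = P (X @^-1` A `&` Y @^-1` B) * P D)%E) ->
  forall C : set (R * R), measurable C ->
  (P ((fun w => (X w, Y w)) @^-1` C `&` D) = P ((fun w => (X w, Y w)) @^-1` C) * P D)%E.
Proof.
move=> mX mY mD H C mC.
pose Z w := (X w, Y w).
have mZ : measurable_fun setT Z by apply/measurable_fun_pair.
pose Z' : {mfun T >-> (R * R)%type} := mfun_Sub (mem_set mZ).
have pD0 : 0 <= fine (P D) by rewrite fine_ge0.
pose m1 : {measure set (R * R) -> \bar R} := pushforward (mrestr P mD) Z'.
pose m2 : {measure set (R * R) -> \bar R} := mscale (NngNum pD0) (distribution P Z').
have PD : (fine (P D))%:E = P D by rewrite fineK// fin_num_measure.
suff : m1 mZ C = m2 C by rewrite /m1 /m2 /= /mscale /distribution /pushforward /mrestr /= PD muleC.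
apply: (measure_unique [set A `*` B | A in measurable & B in measurable] (fun=> setT)) => //.
- by rewrite -measurable_prod_measurableType.
- move=> _ _ [A1 mA1 [B1 mB1 <-]] [A2 mA2 [B2 mB2 <-]].
  rewrite -setXI; exists (A1 `&` A2); first exact: measurableI.
  by exists (B1 `&` B2) => //; exact: measurableI.
- by move=> _; exists setT => //; exists setT => //; rewrite setXTT.
- by rewrite bigcup_const.
- move=> _ [A mA [B mB <-]].
  by rewrite /m1 /m2 /= /mscale /distribution /pushforward /mrestr /= PD muleC; exact: H.
- move=> _; rewrite /m1 /= /pushforward /mrestr.
  by rewrite preimage_setT setTI (le_lt_trans (probability_le1 _ _)) ?ltry.
Qed.

(** The joint law is the product of the marginals, being determined by rectangles; Tonelli then
    separates the variables. Here independence becomes an iterated average. *)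
Lemma ge0_expectation_indep_sum (X Y : T -> R) (F : R -> R) :
  measurable_fun setT X -> measurable_fun setT Y ->
  (forall A B, measurable A -> measurable B ->
     (P (X @^-1` A `&` Y @^-1` B) = P (X @^-1` A) * P (Y @^-1` B))%E) ->
  measurable_fun setT F -> (forall x, 0 <= F x) ->
  (\int[P]_w (F (Y w + X w))%:E = \int[P]_w \int[P]_v (F (Y w + X v))%:E)%E.
Proof.
move=> mX mY H mF F0.
pose X' : {mfun T >-> R} := mfun_Sub (mem_set mX).
pose Y' : {mfun T >-> R} := mfun_Sub (mem_set mY).
pose Z w := (X w, Y w).
have mZ : measurable_fun setT Z by apply/measurable_fun_pair.
pose Z' : {mfun T >-> (R * R)%type} := mfun_Sub (mem_set mZ).
pose G (z : R * R) := (F (z.2 + z.1))%:E.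
have mG : measurable_fun setT G.
  apply/measurable_EFinP; apply: measurableT_comp => //.
  exact: measurable_funD.
have G0 z : (0 <= G z)%E by rewrite lee_fin.
transitivity (\int[distribution P Z']_z G z)%E.
  by rewrite ge0_integral_distribution.
transitivity (\int[distribution P X' \x distribution P Y']_z G z)%E.
  apply: eq_measure_integral => /= C mC _.
  symmetry; apply: (@product_measure_unique _ _ _ _ R (distribution P X')
    (distribution P Y') (distribution P Z')) => //.
rewrite fubini_tonelli1// fubini_tonelli//.
have mG' : measurable_fun setT (fun y : R => \int[distribution P X']_x G (x, y))%E.
  exact: measurable_fun_fubini_tonelli_G.
rewrite ge0_integral_distribution//; last by move=> y; apply: integral_ge0.
apply: eq_integral => w _ /=.
by rewrite ge0_integral_distribution//; apply: measurableT_comp => //.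
Qed.

Context (I : finType) (Y : I -> {RV P >-> R}) (g : I -> R -> R).
Hypothesis Yind : mutually_independent Y.
Hypothesis mg : forall i, measurable_fun setT (g i).

Let xi i w := g i (Y i w).
Let S (s : seq I) w := \sum_(i <- s) xi i w.
Let E (J : {set I}) (A : I -> set R) := \bigcap_(i in [set` J]) (Y i @^-1` A i).

Let mxi i : measurable_fun setT (xi i).
Proof. exact: measurableT_comp. Qed.

Let mS s : measurable_fun setT (S s).
Proof. exact: measurable_sum. Qed.

Let mE J A : (forall i, measurable (A i)) -> measurable (E J A).
Proof.
move=> mA; apply: fin_bigcap_measurable; first exact: finite_finset.
by move=> i _; exact: measurable_preimage.
Qed.

(** The extra event [E J A] is what makes the induction on [s] work: the head [i0] leaves the sum
    and joins the constrained indices, so the induction hypothesis is used with [i0 |: J]. *)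
Lemma indep_sum_event s (J : {set I}) B A : uniq s -> {in s, forall i, i \notin J} ->
  measurable B -> (forall i, measurable (A i)) ->
  (P (S s @^-1` B `&` E J A) = P (S s @^-1` B) * P (E J A))%E.
Proof.
move=> us; elim: s us J B A => [_|i0 s IH /= /andP[i0s us]] J B A sJ mB mA.
  have -> : S [::] = cst 0 by apply/funext => w; rewrite /S big_nil.
  rewrite preimage_cst; case: ifPn => _; first by rewrite setTI probability_setT mul1e.
  by rewrite set0I measure0 mul0e.
have i0J : i0 \notin J by apply: sJ; rewrite inE eqxx.
have sJ' : {in s, forall i, i \notin J} by move=> i si; apply: sJ; rewrite inE si orbT.
have sJ2 : {in s, forall i, i \notin i0 |: J}.
  move=> i si; rewrite !inE negb_or sJ'// andbT.
  by apply: contraNneq i0s => <-.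
(* An event on [xi i0] is an event on [Y i0] through the preimage under [g i0], so it can be merged
   into [E] as one more coordinate and factored by independence. *)
have split_i0 (A1 : set R) (K : {set I}) (A' : I -> set R) : measurable A1 ->
    i0 \notin K -> (forall i, measurable (A' i)) ->
    exists A2 : I -> set R, [/\ forall i, measurable (A2 i),
      E (i0 |: K) A2 = xi i0 @^-1` A1 `&` E K A' &
      P (E (i0 |: K) A2) = (P (xi i0 @^-1` A1) * P (E K A'))%E].
  move=> mA1 i0K mA'; pose A2 i := if i == i0 then g i0 @^-1` A1 else A' i.
  have mA2 i : measurable (A2 i).
    by rewrite /A2; case: eqP => // _; rewrite -[X in measurable X]setTI; exact: mg.
  have E2 : E K A2 = E K A'.
    apply: eq_bigcapr => i /= iK; rewrite /A2; case: eqP => // ii0.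
    by rewrite ii0 (negbTE i0K) in iK.
  have A20 : Y i0 @^-1` A2 i0 = xi i0 @^-1` A1 by rewrite /A2 eqxx.
  have E1 : E (i0 |: K) A2 = xi i0 @^-1` A1 `&` E K A'.
    rewrite -E2 -A20; apply/seteqP; split=> w.
      by move=> h; split=> [|i iK]; apply: h => /=; rewrite !inE ?eqxx// iK orbT.
    move=> [h1 h2] i /=; rewrite !inE => /orP[/eqP->//|iK]; exact: h2.
  exists A2; split=> //.
  rewrite /E (Yind _ mA2) big_setU1//= A20 -(Yind _ mA2) -/(E K A2).
  by rewrite E2.
have rect (K : {set I}) (A' : I -> set R) (A1 B1 : set R) : measurable A1 ->
    measurable B1 -> i0 \notin K ->
    {in s, forall i, i \notin i0 |: K} -> (forall i, measurable (A' i)) ->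
    (P (xi i0 @^-1` A1 `&` S s @^-1` B1 `&` E K A') =
     P (xi i0 @^-1` A1) * P (S s @^-1` B1) * P (E K A'))%E.
  move=> mA1 mB1 i0K sK mA'; have [A2 [mA2 e1 e2]] := split_i0 A1 K A' mA1 i0K mA'.
  rewrite (setIC (xi _ @^-1` _)) -setIA -e1 IH// e2 muleA.
  by rewrite (muleC (P (xi _ @^-1` _))).
have rect0 (A1 B1 : set R) : measurable A1 -> measurable B1 ->
    (P (xi i0 @^-1` A1 `&` S s @^-1` B1) = P (xi i0 @^-1` A1) * P (S s @^-1` B1))%E.
  move=> mA1 mB1; have := rect (finset.set0 : {set I}) (fun=> setT) A1 B1 mA1 mB1.
  have -> : E (finset.set0 : {set I}) (fun=> setT) = setT.
    by apply/seteqP; split=> // w _ i /=; rewrite inE.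
  rewrite setIT probability_setT mule1; apply=> //; first by rewrite inE.
  move=> i si; rewrite !inE orbF.
  by apply: contraNneq i0s => <-.
pose C : set (R * R) := (fun z => z.1 + z.2) @^-1` B.
have mC : measurable C.
  rewrite -[C]setTI; apply: (_ : measurable_fun setT (fun z : R * R => z.1 + z.2)) => //.
  exact: measurable_funD.
have SC : S (i0 :: s) @^-1` B = (fun w => (xi i0 w, S s w)) @^-1` C.
  by apply/seteqP; split=> w; rewrite /C /= /S big_cons.
rewrite SC; apply: pair_event_product => //; first exact: mE.
by move=> A1 B1 mA1 mB1; rewrite rect0// rect.
Qed.

Lemma indep_sum_cons i0 s A B : i0 \notin s -> uniq s -> measurable A -> measurable B ->
  (P (xi i0 @^-1` A `&` S s @^-1` B) = P (xi i0 @^-1` A) * P (S s @^-1` B))%E.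
Proof.
move=> i0s us mA mB.
have := @indep_sum_event s [set i0]%SET B (fun i => g i @^-1` A) us.
have -> : E [set i0]%SET (fun i => g i @^-1` A) = xi i0 @^-1` A.
  apply/seteqP; split=> [w h|w h i /=]; first by apply: (h i0) => /=; rewrite inE.
  by rewrite inE => /eqP ->.
rewrite setIC muleC; apply => //.
- by move=> i si; rewrite inE; apply: contraNneq i0s => <-.
- by move=> i; rewrite -[X in measurable X]setTI; exact: mg.
Qed.

(** The head is averaged out first, replacing [f] by its average while the tail stays random; this
    is the order in which [foldl] consumes the list. *)
Lemma expectation_indep_sum s f : uniq s -> bounded_measurable f -> (forall x, 0 <= f x) ->
  \int[P]_w f (S s w) = foldl (fun f i => avg P (xi i) f) f s 0.
Proof.
elim: s f => [f _ bf f0|i0 s IH f /= /andP[i0s us] bf f0].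
  rewrite /= -[RHS](Rintegral_cst_probability P); congr fine; apply: eq_integral => w _.
  by rewrite /S big_nil.
rewrite -IH//; last 2 first.
  exact: bounded_measurable_avg.
  by move=> x; apply: Rintegral_ge0.
rewrite /Rintegral.
have -> : (\int[P]_x (f (S (i0 :: s) x))%:E = \int[P]_x (f (S s x + xi i0 x))%:E)%E.
  by apply: eq_integral => w _; rewrite /S big_cons addrC.
rewrite (ge0_expectation_indep_sum (mxi i0) (mS s) _ bf.1 f0); last first.
  by move=> A B mA mB; exact: indep_sum_cons.
congr fine; apply: eq_integral => w _.
rewrite /avg /Rintegral fineK//; apply: integrable_fin_num => //.
exact: integrable_shift.
Qed.

(** Averaging over the head kills the cross term because its mean is 0. The extended-real form
    carries finiteness along the induction. *)
Lemma second_moment_indep_sum s (v : I -> R) : uniq s ->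
  (forall i, P.-integrable setT (EFin \o xi i)) ->
  (forall i, P.-integrable setT (fun w => (xi i w ^+ 2)%:E)) ->
  (forall i, \int[P]_w xi i w = 0) -> (forall i, \int[P]_w (xi i w ^+ 2) = v i) ->
  (\int[P]_w (S s w ^+ 2)%:E)%E = (\sum_(i <- s) v i)%:E.
Proof.
move=> us i1 i2 e1 e2; elim: s us => [_|i0 s IH /= /andP[i0s us]].
  rewrite big_nil integral0_eq// => w _; by rewrite /S big_nil expr0n.
have -> : (\int[P]_x (S (i0 :: s) x ^+ 2)%:E = \int[P]_x ((S s x + xi i0 x) ^+ 2)%:E)%E.
  by apply: eq_integral => w _; rewrite /S big_cons addrC.
rewrite (@ge0_expectation_indep_sum (xi i0) (S s) (fun x => x ^+ 2))//; last 2 first.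
- by move=> A B mA mB; exact: indep_sum_cons.
- by move=> x; exact: sqr_ge0.
have inner w : (\int[P]_v0 ((S s w + xi i0 v0) ^+ 2)%:E = (S s w ^+ 2)%:E + (v i0)%:E)%E.
  have j1 : P.-integrable setT (fun v0 => (2 * S s w * xi i0 v0)%:E).
    by under eq_fun do rewrite EFinM; apply: integrableZl => //; exact: i1.
  have j0 : P.-integrable setT (fun v0 => (S s w ^+ 2)%:E).
    exact: finite_measure_integrable_cst.
  have j01 : P.-integrable setT (fun v0 => (S s w ^+ 2 + 2 * S s w * xi i0 v0)%:E).
    by under eq_fun do rewrite EFinD; apply: integrableD.
  have j : P.-integrable setT
      (fun v0 => (S s w ^+ 2 + 2 * S s w * xi i0 v0 + xi i0 v0 ^+ 2)%:E).
    by under eq_fun do rewrite EFinD; apply: integrableD.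
  rewrite -EFinD -(e2 i0).
  have -> : S s w ^+ 2 + \int[P]_w0 xi i0 w0 ^+ 2 =
      \int[P]_v0 (S s w ^+ 2 + 2 * S s w * xi i0 v0 + xi i0 v0 ^+ 2).
    rewrite (RintegralD measurableT j01 (i2 i0)) (RintegralD measurableT j0 j1).
    rewrite (RintegralZl _ measurableT (i1 i0)) e1 mulr0 addr0.
    by rewrite Rintegral_cst_probability.
  rewrite /Rintegral fineK; last exact: integrable_fin_num.
  by apply: eq_integral => v0 _; congr EFin; ring.
under eq_integral do rewrite inner.
rewrite ge0_integralD//; last 3 first.
- by move=> w _; rewrite lee_fin sqr_ge0.
- apply/measurable_EFinP; apply: (measurableT_comp (exprn_measurable 2)); exact: mS.
- by move=> w _; rewrite lee_fin -(e2 i0) Rintegral_ge0// => x _; rewrite sqr_ge0.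
rewrite IH// integral_cst// [X in (_ * X)%E](probability_setT P) mule1 big_cons EFinD.
by rewrite addeC.
Qed.

End independence.

(** * Moments of the normal and chi-square laws *)

Section gaussian.
Context {R : realType}.
Local Notation mu := (@lebesgue_measure R).

Lemma bigcup_itvNSS : \bigcup_n `[- n.+1%:R, n.+1%:R]%classic = [set: R].
Proof.
apply/seteqP; split=> // x _; exists (Num.truncn `|x|) => //=.
rewrite in_itv/= -ler_norml; exact/ltW/truncnS_gt.
Qed.

Lemma ge0_integral_normal_prob (s : R) (g : R -> R) :
  measurable_fun setT g -> (forall x, 0 <= g x) ->
  (\int[normal_prob 0 s]_x (g x)%:E = \int[mu]_x (g x * normal_pdf 0 s x)%:E)%E.
Proof.
move=> mg g0.
apply: (@ge0_integral_density R _ _ (normal_prob 0 s) id (normal_pdf 0 s) g) => //.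
- exact: measurable_normal_pdf.
- by move=> x; exact: normal_pdf_ge0.
Qed.

Lemma measurable_EFinX k : measurable_fun setT (fun x : R => (x ^+ k)%:E).
Proof. by apply/measurable_EFinP; exact: exprn_measurable. Qed.

Lemma measurable_EFin_normal_pdf (s : R) :
  measurable_fun setT (fun x : R => (normal_pdf 0 s x)%:E).
Proof. by apply/measurable_EFinP; exact: measurable_normal_pdf. Qed.

Section normal_moments.
Variable s : R.
Hypothesis s0 : 0 < s.
Let p := normal_pdf 0 s.

Let sN0 : s != 0. Proof. by rewrite gt_eqF. Qed.

Let pE x : p x = normal_peak s * expR (- (x ^+ 2 / (s ^+ 2 *+ 2))).
Proof. by rewrite /p normal_pdfE// /normal_fun subr0 mulNr. Qed.

Lemma is_derive_normal_pdf (x : R) : is_derive x 1 p (- (x / s ^+ 2) * p x).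
Proof.
have H : is_derive x 1 (fun x : R => - (x ^+ 2 / (s ^+ 2 *+ 2))) (- (x / s ^+ 2)).
  apply: (is_derive_eq (is_deriveN (is_deriveM (is_deriveX 2 (is_derive_id x 1))
    (is_derive_cst (s ^+ 2 *+ 2)^-1 x 1)))).
  by rewrite /GRing.scale /= /cst; field.
have H2 := is_deriveM (is_derive_cst (normal_peak s) x 1)
  (@is_derive1_comp _ expR _ x _ _ (is_derive_expR _) H).
rewrite (_ : p = cst (normal_peak s) * (expR \o fun x : R => - (x ^+ 2 / (s ^+ 2 *+ 2)))).
  by apply: (is_derive_eq H2); rewrite /GRing.scale /= !fctE /cst /=; ring.
by apply/funext => y; rewrite pE.
Qed.

Let p_even x : p (- x) = p x.
Proof. by rewrite !pE sqrrN. Qed.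

Let p_ge0 x : 0 <= p x. Proof. exact: normal_pdf_ge0. Qed.

Let cp : continuous p. Proof. exact: continuous_normal_pdf. Qed.

Let cvg_p k : n.+1%:R ^+ k * p n.+1%:R @[n --> \oo] --> (0 : R).
Proof.
have a0 : 0 < (s ^+ 2 *+ 2)^-1 by rewrite invr_gt0 pmulrn_lgt0// exprn_gt0.
(* At points x >= 1 one has x^2 >= x, so the Gaussian tail is dominated by an exponential one. *)
apply: (@squeeze_cvgr _ _ _ _ (cst 0) (fun n => normal_peak s *
  (n.+1%:R ^+ k * expR (- ((s ^+ 2 *+ 2)^-1 * n.+1%:R))))).
- near=> n; rewrite mulr_ge0//= pE mulrCA ler_wpM2l ?normal_peak_ge0//.
  rewrite ler_wpM2l// ler_expR lerN2 mulrC ler_wpM2r ?(ltW a0)//.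
  by rewrite expr2 ler_peMl// ler1n.
- exact: cvg_cst.
- rewrite -[X in _ --> X](mulr0 (normal_peak s)).
  by apply: cvgMr; exact: cvg_powX_expRN.
Unshelve. all: by end_near.
Qed.

Let parts (F f g : R -> R) :
  (forall x : R, is_derive x 1 F (f x - g x)) -> continuous f -> continuous g ->
  (forall x, 0 <= f x) -> (forall x, 0 <= g x) ->
  F n.+1%:R - F (- n.+1%:R) @[n --> \oo] --> (0:R) ->
  (\int[mu]_x (f x)%:E = \int[mu]_x (g x)%:E)%E.
Proof.
move=> dF cf cg f0 g0 H; rewrite -bigcup_itvNSS.
apply: (@integral_parts_exhaust _ F f g (fun n => - n.+1%:R) (fun n => n.+1%:R)) => //.
- by move=> n; rewrite gtrN// ltr0n.
- by move=> m n mn; rewrite lerN2 ler_nat.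
- by move=> m n mn; rewrite ler_nat.
- by move=> n x _; split=> //; [exact: cf|exact: cg].
Qed.

Let ctX k : continuous (fun x : R => x ^+ k).
Proof. by move=> x; exact: exprn_continuous. Qed.

Let ctM (f g : R -> R) : continuous f -> continuous g -> continuous (fun x => f x * g x).
Proof. by move=> cf cg x; apply: cvgM; [exact: cf|exact: cg]. Qed.

Let ct_cst (k : R) : continuous (fun x : R => k).
Proof. by move=> x; exact: cvg_cst. Qed.

Lemma normal_moment2 : (\int[normal_prob 0 s]_x (x ^+ 2)%:E = (s ^+ 2)%:E)%E.
Proof.
rewrite ge0_integral_normal_prob; [|exact: exprn_measurable|by move=> x; exact: sqr_ge0].
rewrite -[RHS]mule1 -(integral_normal_pdf 0 s) -ge0_integralZl//; last 3 first.
- exact: measurable_EFin_normal_pdf.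
- by move=> x _; rewrite lee_fin.
- by rewrite lee_fin sqr_ge0.
(* Since s^2 p' = - x p, the primitive s^2 x p has derivative s^2 p - x^2 p. The fourth moment uses
   s^2 x^3 p likewise. *)
apply/esym; apply: (@parts (fun x => s ^+ 2 * (x * p x)) (fun x => s ^+ 2 * p x)) => //.
- move=> x; apply: (is_derive_eq (is_deriveM (is_derive_cst (s ^+ 2) x 1)
    (is_deriveM (is_derive_id x 1) (is_derive_normal_pdf x)))).
  by rewrite /GRing.scale /= !fctE /cst -/p; field.
- exact: ctM.
- exact: ctM.
- by move=> x; rewrite mulr_ge0// sqr_ge0.
- by move=> x; rewrite mulr_ge0// sqr_ge0.
- have e (x : R) : s ^+ 2 * (x * p x) - s ^+ 2 * (- x * p (- x)) = s ^+ 2 * 2 * (x * p x).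
    by rewrite p_even; ring.
  under eq_fun do rewrite e.
  have := @cvgMr _ _ _ _ (fun n => n.+1%:R * p n.+1%:R) (s ^+ 2 * 2) 0 (cvg_p 1).
  by rewrite mulr0; apply.
Qed.

Lemma normal_moment4 : (\int[normal_prob 0 s]_x (x ^+ 4)%:E = (3 * s ^+ 4)%:E)%E.
Proof.
rewrite ge0_integral_normal_prob; [|exact: exprn_measurable|by move=> x; exact: exprn_even_ge0].
have -> : (3 * s ^+ 4)%:E = ((3 * s ^+ 2)%:E * (s ^+ 2)%:E)%E by rewrite -EFinM; congr EFin; ring.
rewrite -normal_moment2.
rewrite ge0_integral_normal_prob; [|exact: exprn_measurable|by move=> x; exact: sqr_ge0].
rewrite -ge0_integralZl//; last 3 first.
- have : measurable_fun setT (fun x : R => (x ^+ 2 * normal_pdf 0 s x)%:E).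
    apply/measurable_EFinP/measurable_funM; first exact: exprn_measurable.
    exact: measurable_normal_pdf.
  exact.
- by move=> x _; rewrite lee_fin mulr_ge0// sqr_ge0.
- by rewrite lee_fin mulr_ge0// sqr_ge0.
apply/esym; apply: (@parts (fun x => s ^+ 2 * (x ^+ 3 * p x))
  (fun x => 3 * s ^+ 2 * (x ^+ 2 * p x))) => //.
- move=> x; apply: (is_derive_eq (is_deriveM (is_derive_cst (s ^+ 2) x 1)
    (is_deriveM (is_deriveX 3 (is_derive_id x 1)) (is_derive_normal_pdf x)))).
  by rewrite /GRing.scale /= !fctE /cst -/p; field.
- by apply: ctM => //; exact: ctM.
- exact: ctM.
- by move=> x; do 2 apply: mulr_ge0 => //; exact: sqr_ge0.
- by move=> x; rewrite mulr_ge0// exprn_even_ge0.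
- have e (x : R) : s ^+ 2 * (x ^+ 3 * p x) - s ^+ 2 * ((- x) ^+ 3 * p (- x)) =
      s ^+ 2 * 2 * (x ^+ 3 * p x).
    by rewrite p_even; ring.
  under eq_fun do rewrite e.
  have := @cvgMr _ _ _ _ (fun n => n.+1%:R ^+ 3 * p n.+1%:R) (s ^+ 2 * 2) 0 (cvg_p 3).
  by rewrite mulr0; apply.
Qed.

Lemma normal_integrable (k : nat) : (k <= 4)%N ->
  (normal_prob 0 s).-integrable setT (fun x : R => (x ^+ k)%:E).
Proof.
move=> k4.
have i4 : (normal_prob 0 s).-integrable setT (fun x : R => (1 + x ^+ 4)%:E).
  apply/integrableP; split.
    have : measurable_fun setT (fun x : R => (1 + x ^+ 4)%:E).
      by apply/measurable_EFinP/measurable_funD => //; exact: exprn_measurable.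
    exact.
  under eq_integral => x _.
    rewrite abse_EFin ger0_norm ?addr_ge0 ?exprn_even_ge0// EFinD; over.
  rewrite ge0_integralD//; last 2 first.
  - by move=> x _; rewrite lee_fin exprn_even_ge0.
  - exact: measurable_EFinX.
  by rewrite normal_moment4 integral_cst// [X in (_ * X)%E]probability_setT mule1 -EFinD ltry.
apply: le_integrable i4 => //; first exact: measurable_EFinX.
move=> x _ /=; rewrite lee_fin [leRHS]ger0_norm ?addr_ge0 ?exprn_even_ge0//.
rewrite normrX; have [x1|x1] := leP `|x| 1.
  by rewrite (@le_trans _ _ 1) ?exprn_ile1// lerDl exprn_even_ge0.
rewrite -(@ger0_norm _ (x ^+ 4)) ?exprn_even_ge0// normrX.
by rewrite ler_wpDl// ler_weXn2l// ltW.
Qed.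

(** [parts] needs nonnegative integrands, so x is replaced by the pair |x| - x and |x| + x. Against
    [p] their difference - 2 x p is the derivative of 2 s^2 p, whose boundary increments vanish by
    parity. *)
Lemma normal_mean : \int[normal_prob 0 s]_x x = 0.
Proof.
have i1 : (normal_prob 0 s).-integrable setT (EFin \o (@id R)) by exact: (@normal_integrable 1).
have i1' : (normal_prob 0 s).-integrable setT (fun x : R => `|x|%:E).
  exact: (integrable_norm i1).
have pos (e : R) : `|e| = 1 -> (normal_prob 0 s).-integrable setT (fun x : R => (`|x| + e * x)%:E).
  move=> e1; under eq_fun do rewrite EFinD EFinM.
  by apply: integrableD => //; apply: integrableZl.
have ge (e x : R) : `|e| = 1 -> 0 <= `|x| + e * x.
  move=> e1; have : - `|x| <= e * x
    by rewrite lerNl (le_trans (ler_norm _))// normrN normrM e1 mul1r.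
  by rewrite -subr_ge0 opprK addrC.
have mpos (e : R) : measurable_fun setT (fun x : R => `|x| + e * x).
  by apply: measurable_funD => //; exact: measurable_funM.
have ctN (e : R) : continuous (fun x : R => `|x| + e * x).
  move=> x; apply: cvgD; first exact: norm_continuous.
  by apply: cvgM => //; exact: cvg_cst.
have n1 : `|1 : R| = 1 by rewrite normr1.
have nN1 : `|- 1 : R| = 1 by rewrite normrN1.
have E : (\int[normal_prob 0 s]_x (`|x| + (- 1) * x)%:E
        = \int[normal_prob 0 s]_x (`|x| + 1 * x)%:E)%E.
  rewrite !ge0_integral_normal_prob//; [|by move=> x; exact: ge..].
  apply: (@parts (fun x => 2 * s ^+ 2 * p x)).
  - move=> x; apply: (is_derive_eq (is_deriveM (is_derive_cst (2 * s ^+ 2) x 1)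
      (is_derive_normal_pdf x))).
    by rewrite /GRing.scale /cst /= -/p; field.
  - exact: ctM.
  - exact: ctM.
  - by move=> x; rewrite mulr_ge0// ge.
  - by move=> x; rewrite mulr_ge0// ge.
  - under eq_fun do rewrite p_even subrr.
    exact: cvg_cst.
have E' : \int[normal_prob 0 s]_x (`|x| + (- 1) * x) =
    \int[normal_prob 0 s]_x (`|x| + 1 * x) := congr1 fine E.
have D (e : R) : \int[normal_prob 0 s]_x (`|x| + e * x) =
    \int[normal_prob 0 s]_x `|x| + e * \int[normal_prob 0 s]_x x.
  have ie : (normal_prob 0 s).-integrable setT (fun x : R => (e * x)%:E).
    by under eq_fun do rewrite EFinM; apply: integrableZl.
  by rewrite (RintegralD measurableT i1' ie) (RintegralZl _ measurableT i1).
move: E'; rewrite !D mulN1r mul1r => /addrI /eqP.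
by rewrite eq_sym -subr_eq0 opprK -mulr2n mulrn_eq0 => /eqP.
Qed.

(** The third moment is bounded through |x|^3 <= (s / 2) x^2 + x^4 / (2 s), a perfect square
    inequality; the even moments s^2 and 3 s^4 then give s^3 / 2 + 3 s^3 / 2. *)
Lemma normal_moments3 : moments3 (normal_prob 0 s) id (s ^+ 2) (2 * s ^+ 3).
Proof.
have i2 := @normal_integrable 2 isT.
have i4 := @normal_integrable 4 isT.
have i3 : (normal_prob 0 s).-integrable setT (fun x : R => (`|x| ^+ 3)%:E).
  have := integrable_norm (@normal_integrable 3 isT).
  by apply: eq_integrable => // x _ /=; rewrite normrX.
split=> //; first exact: (@normal_integrable 1).
split; [exact: normal_mean|by rewrite /Rintegral normal_moment2|].
have j2 : (normal_prob 0 s).-integrable setT (fun x : R => (s / 2 * x ^+ 2)%:E).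
  by under eq_fun do rewrite EFinM; apply: integrableZl.
have j4 : (normal_prob 0 s).-integrable setT (fun x : R => ((2 * s)^-1 * x ^+ 4)%:E).
  by under eq_fun do rewrite EFinM; apply: integrableZl.
have j24 : (normal_prob 0 s).-integrable setT
    (fun x : R => (s / 2 * x ^+ 2 + (2 * s)^-1 * x ^+ 4)%:E).
  by under eq_fun do rewrite EFinD; apply: integrableD.
apply: (@le_trans _ _ (\int[normal_prob 0 s]_x (s / 2 * x ^+ 2 + (2 * s)^-1 * x ^+ 4))).
  apply: le_Rintegral => //.
  move=> x _; rewrite -subr_ge0.
  have -> : s / 2 * x ^+ 2 + (2 * s)^-1 * x ^+ 4 - `|x| ^+ 3 =
     (2 * s)^-1 * (`|x| * (`|x| - s)) ^+ 2.
    have -> : x ^+ 4 = `|x| ^+ 4 by rewrite -normrX ger0_norm// exprn_even_ge0.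
    have -> : x ^+ 2 = `|x| ^+ 2 by rewrite -normrX ger0_norm// exprn_even_ge0.
    by field.
  by rewrite mulr_ge0 ?sqr_ge0// invr_ge0 mulr_ge0// ltW.
rewrite RintegralD// !RintegralZl// /Rintegral normal_moment2 normal_moment4 /=.
by rewrite le_eqVlt; apply/orP; left; apply/eqP; field.
Qed.

End normal_moments.
End gaussian.

Section chi_square_moments.
Context {R : realType}.
Local Notation mu := (@lebesgue_measure R).
Variable c : nat.
Hypothesis c0 : (0 < c)%N.
Let a : R := c%:R / 2.
Let K : R := (2 `^ a * gamma_fun a)^-1.
Let p : R -> R := chi2_pdf c.

Let a0 : 0 < a. Proof. by rewrite divr_gt0// ltr0n. Qed.

Let K0 : 0 <= K.
Proof.
rewrite invr_ge0 mulr_ge0 ?powR_ge0// Rintegral_ge0// => x _.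
by rewrite mulr_ge0 ?powR_ge0 ?expR_ge0.
Qed.

Lemma chi2_pdf_ge0 x : 0 <= p x.
Proof.
rewrite /p /chi2_pdf; case: ifPn => // _.
by rewrite mulr_ge0 ?mulr_ge0 ?powR_ge0 ?expR_ge0.
Qed.

Lemma measurable_chi2_pdf : measurable_fun setT p.
Proof.
rewrite /p /chi2_pdf; apply: measurable_fun_ifT => //.
- exact: measurable_fun_ltr.
- apply: measurable_funM => //; apply: measurable_funM.
    exact: measurable_powR.
  by apply: measurableT_comp => //; apply: measurable_funM.
Qed.

(** Compact exhaustion of the open half-line, away from 0 where the density may blow up. Starting at
    2 keeps the first segment from degenerating to a point. *)
Let D : set R := \bigcup_n `[n.+2%:R^-1, n.+2%:R]%classic.

Let DE : D = `]0, +oo[%classic.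
Proof.
apply/seteqP; split=> x.
  move=> [n _ /=]; rewrite !in_itv/= andbT => /andP[+ _]; apply: lt_le_trans.
  by rewrite invr_gt0 ltr0n.
rewrite /= in_itv/= andbT => x0.
exists (Num.truncn (Num.max x x^-1)) => //=; rewrite in_itv/=.
have h : Num.max x x^-1 <= (Num.truncn (Num.max x x^-1)).+2%:R.
  by rewrite (le_trans (ltW (truncnS_gt _)))// ler_nat.
rewrite -[X in _ <= X <= _]invrK lef_pV2 ?posrE ?invr_gt0 ?ltr0n//.
by apply/andP; split; [|rewrite invrK]; apply: le_trans h; rewrite le_max lexx ?orbT.
Qed.

Let q k (x : R) := K * (x `^ (k%:R + a - 1) * expR (- x / 2)).

Let pE k x : 0 < x -> x ^+ k * p x = q k x.
Proof.
move=> x0; rewrite /p /chi2_pdf x0 /q -/a -/K mulrC mulrAC [in RHS]mulrC.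
congr (_ * _); rewrite mulrAC; congr (_ * _).
rewrite -powR_mulrn ?ltW// -powRD.
  by congr (_ `^ _); ring.
by rewrite (gt_eqF x0) implybT.
Qed.

Let integral_D k : (\int[mu]_x (x ^+ k * p x)%:E = \int[mu]_(x in D) (q k x)%:E)%E.
Proof.
rewrite [RHS]integral_mkcond; apply: eq_integral => x _.
rewrite patchE; case: ifPn; rewrite DE => /=.
  by rewrite inE/= in_itv/= andbT => x0; rewrite pE.
rewrite notin_setE/= in_itv/= andbT => /negP x0.
by rewrite /p /chi2_pdf (negbTE x0) mulr0.
Qed.

Let is_derive_q k (x : R) : 0 < x ->
  is_derive x 1 (q k) (K * ((k%:R + a - 1) * x `^ (k%:R + a - 1 - 1) * expR (- x / 2)
     - x `^ (k%:R + a - 1) * expR (- x / 2) / 2)).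
Proof.
move=> x0.
have H : is_derive x 1 (fun x : R => - x / 2) (- 2^-1).
  apply: (is_derive_eq (is_deriveM (is_deriveN (is_derive_id x 1)) (is_derive_cst (2^-1 : R) x 1))).
  by rewrite /GRing.scale /= /cst; ring.
have H1 := is_deriveM (is_derive_cst K x 1) (is_deriveM
  (@is_derive1_powR _ (k%:R + a - 1) x x0)
  (@is_derive1_comp _ expR _ x _ _ (is_derive_expR _) H)).
by apply: (is_derive_eq H1); rewrite /GRing.scale /= !fctE /cst /=; ring.
Qed.

(** The power in [q k.+1] has exponent k + a, and 2 (k + a) = c + 2 k is the ratio of consecutive
    moments. *)
Let is_derive_primitive k (x : R) : 0 < x ->
  is_derive x 1 (fun x => 2 * q k.+1 x) ((c%:R + 2 * k%:R) * q k x - q k.+1 x).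
Proof.
move=> x0.
apply: (is_derive_eq (is_deriveM (is_derive_cst (2 : R) x 1) (is_derive_q k.+1 x0))).
rewrite /GRing.scale /= /cst /q.
have -> : k.+1%:R + a - 1 - 1 = k%:R + a - 1 by rewrite -natr1; ring.
have -> : c%:R = 2 * a by rewrite /a; field.
by rewrite -natr1; field.
Qed.

Let continuous_q k (x : R) : 0 < x -> {for x, continuous (q k)}.
Proof.
move=> /(is_derive_q k) [dq _].
by apply: differentiable_continuous; apply/derivable1_diffP.
Qed.

Let q_ge0 k x : 0 <= q k x.
Proof. by rewrite /q !mulr_ge0 ?powR_ge0 ?expR_ge0. Qed.

Let cvg_q_infty k : q k.+1 n.+2%:R @[n --> \oo] --> (0:R).
Proof.
have := @cvg_powX_expRN R (k + c) 2^-1; rewrite invr_gt0 ltr0n => /(_ isT).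
rewrite -cvg_shiftS /= => H.
apply: (@squeeze_cvgr _ _ _ _ (cst 0) (fun n => K *
   (n.+2%:R ^+ (k + c) * expR (- (2^-1 * n.+2%:R))))).
- near=> n; rewrite q_ge0 /q ler_wpM2l//= mulNr (mulrC 2^-1) ler_wpM2r ?expR_ge0//.
  (* The base is at least 1 and a <= c, so the real exponent k + a is raised to the integer k +
     c. *)
  rewrite -powR_mulrn// ler_powR ?ler1n// natrD -natr1.
  have : a <= c%:R by rewrite /a ler_piMr// invf_le1// ler1n.
  by lra.
- exact: cvg_cst.
- have := @cvgMr _ _ _ _ (fun n => n.+2%:R ^+ (k + c) * expR (- (2^-1 * n.+2%:R))) K 0 H.
  by rewrite mulr0; apply.
Unshelve. all: by end_near.
Qed.

Let cvg_q_0 k : q k.+1 n.+2%:R^-1 @[n --> \oo] --> (0:R).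
Proof.
have inv0 : Num.sqrt (n.+2%:R^-1 : R) @[n --> \oo] --> (0:R).
  rewrite -[X in _ --> X]sqrtr0; apply: continuous_cvg; first exact: sqrt_continuous.
  by have := @cvg_harmonic R; rewrite -cvg_shiftS.
apply: (@squeeze_cvgr _ _ _ _ (cst 0) (fun n => K * Num.sqrt n.+2%:R^-1)).
(* Near 0 the exponent k + a is at least 1 / 2, the extreme case being c = 1 and k = 0; hence
   domination by a square root. *)
- near=> n; rewrite q_ge0 /q ler_wpM2l//= -powR12_sqrt ?invr_ge0//.
  apply: (@le_trans _ _ (n.+2%:R^-1 `^ (k.+1%:R + a - 1))).
    by rewrite ler_piMr ?powR_ge0// -expR0 ler_expR mulNr oppr_le0 divr_ge0// invr_ge0.
  rewrite ger_powR// ?invr_gt0 ?ltr0n ?invf_le1 ?ler1n//.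
  have : 2^-1 <= a by rewrite /a ler_peMl// ler1n.
  have := ler0n R k; rewrite -natr1; lra.
- exact: cvg_cst.
- have := @cvgMr _ _ _ _ (fun n => Num.sqrt (n.+2%:R^-1 : R)) K 0 inv0.
  by rewrite mulr0; apply.
Unshelve. all: by end_near.
Qed.

(** Integration by parts with primitive [2 * q k.+1], whose values at both ends of the exhaustion
    tend to 0. Finiteness propagates from one moment to the next. *)
Lemma chi2_moment_step k : (\int[mu]_x (x ^+ k.+1 * p x)%:E =
  (c%:R + 2 * k%:R)%:E * \int[mu]_x (x ^+ k * p x)%:E)%E.
Proof.
have ge x : (0 <= (x ^+ k * p x)%:E)%E.
  rewrite lee_fin; have [x0|x0] := ltP 0 x; first by rewrite pE.
  by rewrite /p /chi2_pdf ltNge x0 mulr0.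
have mk : measurable_fun setT (fun x : R => (x ^+ k * p x)%:E).
  apply/measurable_EFinP; apply: measurable_funM; first exact: exprn_measurable.
  exact: measurable_chi2_pdf.
rewrite -ge0_integralZl//.
rewrite integral_D; apply/esym.
have -> : (\int[mu]_x ((c%:R + 2 * k%:R)%:E * (x ^+ k * p x)%:E) =
    \int[mu]_(x in D) ((c%:R + 2 * k%:R) * q k x)%:E)%E.
  rewrite [RHS]integral_mkcond; apply: eq_integral => x _.
  rewrite patchE -EFinM; case: ifPn; rewrite DE => /=.
    by rewrite inE/= in_itv/= andbT => x0; rewrite pE.
  rewrite notin_setE/= in_itv/= andbT => /negP x0.
  by rewrite /p /chi2_pdf (negbTE x0) !mulr0.
apply: (@integral_parts_exhaust _ (fun x => 2 * q k.+1 x) (fun x => (c%:R + 2 * k%:R) * q k x)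
  (q k.+1) (fun n => n.+2%:R^-1) (fun n => n.+2%:R)).
- by move=> n; rewrite (@lt_trans _ _ 1)// ?invf_lt1 ?ltr1n.
- by move=> m n mn; rewrite lef_pV2 ?posrE ?ltr0n// ler_nat.
- by move=> m n mn; rewrite ler_nat.
- move=> n x /andP[h _].
  have x0 : 0 < x by rewrite (lt_le_trans _ h)// invr_gt0.
  split=> //; [exact: is_derive_primitive| |exact: continuous_q|].
    by apply: cvgM; [exact: cvg_cst|exact: continuous_q].
  by rewrite mulr_ge0// addr_ge0// mulr_ge0.
- have h1 := @cvgMr _ _ _ _ (fun n => q k.+1 n.+2%:R) 2 0 (cvg_q_infty k) _.
  have h2 := @cvgMr _ _ _ _ (fun n => q k.+1 n.+2%:R^-1) 2 0 (cvg_q_0 k) _.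
  by have := @cvgB _ R^o _ _ _ _ _ _ _ (h1 _) (h2 _); rewrite subrr; apply.
Qed.

(** The raw moment c (c + 2) ... (c + 2 k - 2), that is 2^k times the rising factorial of c / 2. *)
Definition chi2_moment k : R := \prod_(j < k) (c%:R + 2 * j%:R).

Lemma chi2_momentE : (\int[mu]_x (p x)%:E = 1)%E ->
  forall k, (\int[mu]_x (x ^+ k * p x)%:E = (chi2_moment k)%:E)%E.
Proof.
move=> p1; elim=> [|k IH].
  by rewrite /chi2_moment big_ord0 -p1; apply: eq_integral => x _; rewrite expr0 mul1r.
by rewrite chi2_moment_step IH /chi2_moment big_ord_recr /= -EFinM mulrC.
Qed.

Context d (T : measurableType d) (P : probability T R) (X : T -> R).
Hypothesis mX : measurable_fun setT X.
Hypothesis lawX : has_law P X (chi2_prob c).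

(* That the density has mass 1 is read off the existence of a variable with this
   law, so the Gamma function never has to be evaluated. *)
Let p1 : (\int[mu]_x (p x)%:E = 1)%E.
Proof.
by have := lawX measurableT; rewrite preimage_setT probability_setT => ->.
Qed.

Let law_ge0 (g : R -> R) : measurable_fun setT g -> (forall x, 0 <= g x) ->
  (\int[P]_w (g (X w))%:E = \int[mu]_x (g x * p x)%:E)%E.
Proof.
move=> mg g0.
apply: (ge0_integral_density mX measurable_chi2_pdf chi2_pdf_ge0 _ mg g0).
exact: lawX.
Qed.

Let mXn k : measurable_fun setT (fun w => X w ^+ k).
Proof. exact: measurable_funX. Qed.

Lemma chi2_integrable k : P.-integrable setT (fun w => (X w ^+ k)%:E).
Proof.
apply/integrableP; split; first exact/measurable_EFinP.
rewrite (_ : (\int[P]_x _)%E = (\int[P]_w (`|X w| ^+ k)%:E)%E); last first.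
  by apply: eq_integral => w _; rewrite abse_EFin normrX.
rewrite (law_ge0 (g := fun x => `|x| ^+ k))//; last first.
  by apply: measurable_funX; exact: normr_measurable.
rewrite (_ : (\int[mu]_x _)%E = (chi2_moment k)%:E) ?ltry//.
rewrite -(chi2_momentE p1); apply: eq_integral => x _.
rewrite /p /chi2_pdf; case: ifPn => x0; last by rewrite !mulr0.
by rewrite gtr0_norm.
Qed.

(** The transfer [law_ge0] handles nonnegative functions, so |X|^k is computed first; the
    nonnegative difference |X|^k - X^k integrates to 0 because the density vanishes off the positive
    axis. *)
Lemma chi2_expectation k : \int[P]_w (X w ^+ k) = chi2_moment k.
Proof.
have i2 : P.-integrable setT (fun w => (`|X w| ^+ k)%:E).
  have := integrable_norm (chi2_integrable k).
  by apply: eq_integrable => // w _ /=; rewrite normrX.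
have E1 : \int[P]_w (`|X w| ^+ k - X w ^+ k) = 0.
  rewrite /Rintegral (law_ge0 (g := fun x => `|x| ^+ k - x ^+ k)).
  - rewrite integral0_eq// => x _; rewrite /p /chi2_pdf.
    case: ifPn => x0; last by rewrite mulr0.
    by rewrite gtr0_norm// subrr mul0r.
  - apply: measurable_funB; last exact: exprn_measurable.
    by apply: measurable_funX; exact: normr_measurable.
  - by move=> x; rewrite subr_ge0 -normrX ler_norm.
have E2 : \int[P]_w (`|X w| ^+ k) = chi2_moment k.
  rewrite /Rintegral (law_ge0 (g := fun x => `|x| ^+ k))//; last first.
    by apply: measurable_funX; exact: normr_measurable.
  rewrite (_ : (\int[mu]_x _)%E = (chi2_moment k)%:E)//.
  rewrite -(chi2_momentE p1); apply: eq_integral => x _.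
  rewrite /p /chi2_pdf; case: ifPn => x0; last by rewrite !mulr0.
  by rewrite gtr0_norm.
move: E1; rewrite RintegralB//; last exact: chi2_integrable.
by rewrite E2 => /eqP; rewrite subr_eq0 => /eqP.
Qed.

Lemma chi2_expectation_sum n (b : nat -> R) :
  P.-integrable setT (fun w => (\sum_(i < n) b i * X w ^+ i)%:E) /\
  \int[P]_w (\sum_(i < n) b i * X w ^+ i) = \sum_(i < n) b i * chi2_moment i.
Proof.
elim: n => [|n [IH1 IH2]].
  rewrite big_ord0; split.
    under eq_fun do rewrite big_ord0; exact: finite_measure_integrable_cst.
  by under eq_Rintegral do rewrite big_ord0; rewrite Rintegral_cst_probability.
have i1 : P.-integrable setT (fun w => (b n * X w ^+ n)%:E).
  by under eq_fun do rewrite EFinM; apply: integrableZl => //; exact: chi2_integrable.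
split.
  by under eq_fun do rewrite big_ord_recr EFinD; apply: integrableD.
under eq_Rintegral do rewrite big_ord_recr /=.
rewrite (RintegralD measurableT IH1 i1) IH2 big_ord_recr /=.
by rewrite (RintegralZl _ measurableT (chi2_integrable n)) chi2_expectation.
Qed.

Lemma chi2_expectation_poly (r : {poly R}) :
  P.-integrable setT (fun w => (r.[X w])%:E) /\
  \int[P]_w r.[X w] = \sum_(i < size r) r`_i * chi2_moment i.
Proof.
have [h1 h2] := chi2_expectation_sum (size r) (fun i => r`_i).
split.
  by under eq_fun do rewrite horner_coef.
by under eq_Rintegral do rewrite horner_coef.
Qed.

(* The third moment is bounded through |r|^3 <= 1 + r^4, by a quantity that does
   not depend on [X] or [P]. *)
Lemma moments3_poly (r : {poly R}) v :
  \int[P]_w r.[X w] = 0 -> \int[P]_w (r.[X w] ^+ 2) = v ->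
  moments3 P (fun w => r.[X w]) v
    (\sum_(i < size (1 + r ^+ 4)) (1 + r ^+ 4)`_i * chi2_moment i).
Proof.
move=> e1 e2.
have [i1 _] := chi2_expectation_poly r.
have [i2 _] := chi2_expectation_poly (r ^+ 2).
have [i4 <-] := chi2_expectation_poly (1 + r ^+ 4).
have i2' : P.-integrable setT (fun w => (r.[X w] ^+ 2)%:E).
  by under eq_fun do rewrite -horner_exp.
have bound w : `|r.[X w]| ^+ 3 <= (1 + r ^+ 4).[X w].
  rewrite hornerD hornerC horner_exp -[X in 1 + X]ger0_norm ?exprn_even_ge0// normrX.
  have := normr_ge0 r.[X w]; move: `|r.[X w]| => y y0.
  have [y1|y1] := leP y 1; first by rewrite (@le_trans _ _ 1) ?exprn_ile1// lerDl exprn_ge0.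
  by rewrite ler_wpDl// ler_weXn2l// ltW.
have i3 : P.-integrable setT (fun w => (`|r.[X w]| ^+ 3)%:E).
  apply: le_integrable i4 => //.
    apply/measurable_EFinP; apply: measurable_funX; apply: measurableT_comp => //.
    by apply/measurable_EFinP; exact: measurable_int i1.
  move=> w _ /=; rewrite lee_fin ger0_norm ?exprn_ge0// (le_trans (bound w))//.
  exact: ler_norm.
by split=> //; split=> //; apply: le_Rintegral.
Qed.

Lemma chi2_centered : \int[P]_w (X w - c%:R) = 0 /\ \int[P]_w ((X w - c%:R) ^+ 2) = 2 * c%:R.
Proof.
pose b1 := nth 0 [:: - c%:R; 1] : nat -> R.
pose b2 := nth 0 [:: c%:R ^+ 2; - 2 * c%:R; 1] : nat -> R.
have [_ h1] := chi2_expectation_sum 2 b1.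
have [_ h2] := chi2_expectation_sum 3 b2.
split.
- rewrite (_ : \int[P]_w _ = \int[P]_w (\sum_(i < 2) b1 i * X w ^+ i)).
    by rewrite h1 /b1 /chi2_moment !(big_ord_recr, big_ord0) /=; ring.
  by apply: eq_Rintegral => w _; rewrite /b1 !(big_ord_recr, big_ord0) /=; ring.
- rewrite (_ : \int[P]_w _ = \int[P]_w (\sum_(i < 3) b2 i * X w ^+ i)).
    by rewrite h2 /b2 /chi2_moment !(big_ord_recr, big_ord0) /=; ring.
  by apply: eq_Rintegral => w _; rewrite /b2 !(big_ord_recr, big_ord0) /=; ring.
Qed.

(** The second value is the fourth central moment 12 c^2 + 48 c minus (2 c)^2. The lists [b1] and
    [b2] hold the coefficients of the expanded polynomials, lowest degree first. *)
Lemma chi2_centered_sqr :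
  \int[P]_w ((X w - c%:R) ^+ 2 - 2 * c%:R) = 0 /\
  \int[P]_w (((X w - c%:R) ^+ 2 - 2 * c%:R) ^+ 2) = 8 * c%:R ^+ 2 + 48 * c%:R.
Proof.
pose C : R := c%:R.
pose b1 := nth 0 [:: C ^+ 2 - 2 * C; - 2 * C; 1] : nat -> R.
pose b2 := nth 0 [:: (C ^+ 2 - 2 * C) ^+ 2; - 4 * C * (C ^+ 2 - 2 * C);
   4 * C ^+ 2 + 2 * (C ^+ 2 - 2 * C); - 4 * C; 1] : nat -> R.
have [_ h1] := chi2_expectation_sum 3 b1.
have [_ h2] := chi2_expectation_sum 5 b2.
split.
- rewrite (_ : \int[P]_w _ = \int[P]_w (\sum_(i < 3) b1 i * X w ^+ i)).
    by rewrite h1 /b1 /chi2_moment !(big_ord_recr, big_ord0) /= -/C; ring.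
  by apply: eq_Rintegral => w _; rewrite /b1 !(big_ord_recr, big_ord0) /= -/C; ring.
- rewrite (_ : \int[P]_w _ = \int[P]_w (\sum_(i < 5) b2 i * X w ^+ i)).
    by rewrite h2 /b2 /chi2_moment !(big_ord_recr, big_ord0) /= -/C; ring.
  by apply: eq_Rintegral => w _; rewrite /b2 !(big_ord_recr, big_ord0) /= -/C; ring.
Qed.

End chi_square_moments.

(** * Lindeberg replacement *)

Section gaussian_semigroup.
Context {R : realType}.
Local Notation mu := (@lebesgue_measure R).

Definition gauss_avg (s : R) (f : R -> R) (x : R) : R := avg (normal_prob 0 s) id f x.

Lemma gauss_avgE (s : R) f x : bounded_measurable f -> (forall x, 0 <= f x) ->
  ((gauss_avg s f x)%:E = \int[mu]_y (f (x + y) * normal_pdf 0 s y)%:E)%E.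
Proof.
move=> bf f0; rewrite /gauss_avg /avg /Rintegral fineK; last first.
  apply: integrable_fin_num => //.
  exact: (@integrable_shift _ _ _ (normal_prob 0 s) id (@measurable_id _ _ _) f x bf).
rewrite (@ge0_integral_normal_prob _ s (fun y => f (x + y)))//.
by apply: measurableT_comp; [exact: bf.1|exact: measurable_funD].
Qed.

(** Convolution form: the substitution y = w - x moves [x] from [f] to the kernel, so that two
    averagings can be interchanged by Tonelli. *)
Lemma gauss_avg_kernel (s : R) f x : s != 0 -> continuous f ->
  bounded_measurable f -> (forall x, 0 <= f x) ->
  ((gauss_avg s f x)%:E = \int[mu]_w (f w * normal_pdf 0 s (w - x))%:E)%E.
Proof.
move=> s0 cf bf f0; rewrite (gauss_avgE s x bf f0).
have D (w : R) : is_derive w 1 (fun w : R => w - x) 1.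
  by apply: (is_derive_eq (is_deriveB (is_derive_id w 1) (is_derive_cst x w 1))); rewrite subr0.
have F' : (fun w : R => w - x)^`()%classic = cst 1.
  by apply/funext => w; rewrite derive1E; case: (D w).
rewrite (@increasing_ge0_integration_by_substitutionT _ (fun w : R => w - x)).
- by apply: eq_integral => w _; rewrite F' !fctE /= mulr1 addrC subrK.
- by move=> u w uw; rewrite ltrD2r.
- by rewrite F' => w; exact: cvg_cst.
- by rewrite F'; exact: is_cvg_cst.
- by rewrite F'; exact: is_cvg_cst.
- by move=> w; case: (D w).
- exact: cvg_addrr_Ny.
- exact: cvg_addrr.
- move=> y; apply: cvgM; last exact: continuous_normal_pdf.
  apply: continuous_comp; last exact: cf.
  by apply: cvgD; [exact: cvg_cst|exact: cvg_id].
- by move=> y; rewrite mulr_ge0// normal_pdf_ge0.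
Qed.

(** Completing the square in the intermediate point [u]. The second factor is the conditional
    density of [u] given both endpoints, hence integrates to 1 and leaves the convolved kernel. *)
Lemma normal_pdf_mul (a b u w x : R) : 0 < a -> 0 < b ->
  let c := Num.sqrt (a ^+ 2 + b ^+ 2) in
  normal_pdf 0 b (w - u) * normal_pdf 0 a (u - x) =
  normal_pdf 0 c (w - x) *
    normal_pdf ((b ^+ 2 * x + a ^+ 2 * w) / c ^+ 2) (a * b / c) u.
Proof.
move=> a0 b0 c.
have s0 : 0 < a ^+ 2 + b ^+ 2 by rewrite addr_gt0// exprn_gt0.
have c0 : 0 < c by rewrite sqrtr_gt0.
have c2 : c ^+ 2 = a ^+ 2 + b ^+ 2 by rewrite sqr_sqrtr// ltW.
have an : a != 0 by rewrite gt_eqF.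
have bn : b != 0 by rewrite gt_eqF.
have cn : c != 0 by rewrite gt_eqF.
have dn : a * b / c != 0 by rewrite !mulf_neq0// invr_eq0.
rewrite !normal_pdfE// mulrACA [RHS]mulrACA; congr (_ * _).
  rewrite /normal_peak -!invfM -!sqrtrM; last 2 first.
  - by rewrite pmulrn_lge0// mulr_ge0 ?sqr_ge0 ?pi_ge0.
  - by rewrite pmulrn_lge0// mulr_ge0 ?sqr_ge0 ?pi_ge0.
  by congr (Num.sqrt _)^-1; field.
rewrite /normal_fun -!expRD; congr expR.
rewrite [(a * b / c) ^+ 2]expr_div_n c2.
by field; rewrite an bn gt_eqF.
Qed.

Lemma gauss_avg_add (M a b : R) f : 0 < a -> 0 < b -> smooth3 M f -> (forall x, 0 <= f x) ->
  gauss_avg a (gauss_avg b f) =1 gauss_avg (Num.sqrt (a ^+ 2 + b ^+ 2)) f.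
Proof.
move=> a0 b0 sf f0 x; apply/EFin_inj.
have c0 : 0 < Num.sqrt (a ^+ 2 + b ^+ 2) by rewrite sqrtr_gt0 addr_gt0// exprn_gt0.
have sGf : smooth3 M (gauss_avg b f) by apply: smooth3_avg => //; exact: measurable_id.
have Gf0 y : 0 <= gauss_avg b f y by apply: Rintegral_ge0 => z _; exact: f0.
have cf := smooth3_continuous sf; have bf := smooth3_bounded_measurable sf.
have cG := smooth3_continuous sGf.
have bG := smooth3_bounded_measurable sGf.
have E1 := @gauss_avg_kernel a (gauss_avg b f) x (lt0r_neq0 a0) cG bG Gf0.
have E2 := @gauss_avg_kernel _ f x (lt0r_neq0 c0) cf bf f0.
apply: (etrans E1); apply: esym; apply: (etrans E2); apply: esym => {E1 E2 cG bG}.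
pose H (z : measurableTypeR R * measurableTypeR R) : \bar R :=
  (f z.2 * normal_pdf 0 b (z.2 - z.1) * normal_pdf 0 a (z.1 - x))%:E.
have mH : measurable_fun setT H.
  have m1 : measurable_fun setT (fun z : measurableTypeR R * measurableTypeR R => z.1 : R).
    exact: measurable_fst.
  have m2 : measurable_fun setT (fun z : measurableTypeR R * measurableTypeR R => z.2 : R).
    exact: measurable_snd.
  apply/measurable_EFinP; apply: measurable_funM; first apply: measurable_funM.
  - by apply: measurableT_comp m2; exact: bf.1.
  - apply: measurableT_comp; first exact: measurable_normal_pdf.
    exact: measurable_funB.
  - apply: measurableT_comp; first exact: measurable_normal_pdf.
    exact: measurable_funB.
have H0 z : (0 <= H z)%E by rewrite lee_fin !mulr_ge0 ?normal_pdf_ge0.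
transitivity (\int[mu]_u \int[mu]_w H (u, w))%E.
  apply: eq_integral => u _; rewrite EFinM (gauss_avg_kernel u (lt0r_neq0 b0) cf bf f0).
  rewrite -ge0_integralZr//; last 3 first.
  - apply/measurable_EFinP; apply: measurable_funM; first exact: bf.1.
    apply: measurableT_comp; first exact: measurable_normal_pdf.
    exact: measurable_funB.
  - by move=> w _; rewrite lee_fin mulr_ge0 ?normal_pdf_ge0.
  - by rewrite lee_fin normal_pdf_ge0.
rewrite fubini_tonelli//; apply: eq_integral => w _.
rewrite /H /=.
under eq_integral do rewrite -mulrA normal_pdf_mul// mulrA EFinM.
rewrite ge0_integralZl//; last 3 first.
- by apply/measurable_EFinP; exact: measurable_normal_pdf.
- by move=> y _; rewrite lee_fin normal_pdf_ge0.
- by rewrite lee_fin mulr_ge0 ?normal_pdf_ge0.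
by rewrite integral_normal_pdf mule1.
Qed.

(** The semigroup law is available for positive standard deviations, so the fold starts from a
    function that one Gaussian has already averaged; a nonempty list supplies it in
    [lindeberg_bound]. *)
Lemma foldl_gauss_avg (M : R) (I : Type) (s : seq I) (v : I -> R) (t : R) f :
  0 < t -> (forall i, 0 < v i) -> smooth3 M f -> (forall x, 0 <= f x) ->
  foldl (fun f i => gauss_avg (Num.sqrt (v i)) f) (gauss_avg t f) s =
  gauss_avg (Num.sqrt (t ^+ 2 + \sum_(i <- s) v i)) f.
Proof.
move=> t0 v0 sf f0; elim: s t t0 => [|i s IH] t t0 /=.
  by rewrite big_nil addr0 sqrtr_sqr gtr0_norm.
have -> : gauss_avg (Num.sqrt (v i)) (gauss_avg t f) = gauss_avg (Num.sqrt (t ^+ 2 + v i)) f.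
  have vi : 0 < Num.sqrt (v i) by rewrite sqrtr_gt0.
  have -> : t ^+ 2 + v i = Num.sqrt (v i) ^+ 2 + t ^+ 2.
    by rewrite sqr_sqrtr ?ltW// addrC.
  by apply/funext => x; exact: (gauss_avg_add vi t0 sf f0 x).
rewrite IH; last by rewrite sqrtr_gt0 addr_gt0// exprn_gt0.
by rewrite sqr_sqrtr ?big_cons ?addrA// ltW// addr_gt0// exprn_gt0.
Qed.

End gaussian_semigroup.

Section lindeberg.
Context d (T : measurableType d) (R : realType) (P : probability T R).
Context (I : finType) (Y : I -> {RV P >-> R}) (g : I -> R -> R).
Hypothesis Yind : mutually_independent Y.
Hypothesis mg : forall i, measurable_fun setT (g i).

Lemma lindeberg_bound (M : R) f (s : seq I) (v rho : I -> R) :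
  0 <= M -> smooth3 M f -> (forall x, 0 <= f x) -> uniq s -> s != [::] ->
  (forall i, 0 < v i) -> (forall i, moments3 P (fun w => g i (Y i w)) (v i) (rho i)) ->
  `| \int[P]_w f (\sum_(i <- s) g i (Y i w))
     - gauss_avg (Num.sqrt (\sum_(i <- s) v i)) f 0 | <=
  M * \sum_(i <- s) (rho i + 2 * Num.sqrt (v i) ^+ 3).
Proof.
move=> M0 sf f0 us; case: s us => [//|i0 s] us _ v0 mom.
rewrite (expectation_indep_sum Yind mg us (smooth3_bounded_measurable sf) f0).
have -> : gauss_avg (Num.sqrt (\sum_(i <- i0 :: s) v i)) f =
    foldl (fun f i => avg (normal_prob 0 (Num.sqrt (v i))) id f) f (i0 :: s).
  have si : 0 < Num.sqrt (v i0) by rewrite sqrtr_gt0.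
  have := @foldl_gauss_avg R M I s v (Num.sqrt (v i0)) f si v0 sf f0.
  by rewrite (sqr_sqrtr (ltW (v0 i0))) big_cons => /esym.
apply: (@foldl_avg_compare _ _ _ P _ _ I (i0 :: s) (fun i w => g i (Y i w))
  (fun i => normal_prob 0 (Num.sqrt (v i))) (fun i => id) v rho
  (fun i => 2 * Num.sqrt (v i) ^+ 3) M f 0) => //.
- by move=> i; exact: measurableT_comp.
- move=> i; have := @normal_moments3 R (Num.sqrt (v i)).
  by rewrite sqr_sqrtr ?ltW//; apply; rewrite sqrtr_gt0.
Qed.

End lindeberg.

(** * Convergence in distribution *)

Section slutsky.
Context {R : realType}.

Section tail_comparison.
Context d (T : measurableType d) (P : probability T R) (X : T -> R).
Hypothesis mX : measurable_fun setT X.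

Let A b := X @^-1` `]-oo, b].

Let mA b : measurable (A b).
Proof. by apply: measurable_preimage => //; exact: measurable_itv. Qed.

Let PE b : \int[P]_w (\1_(A b) w) = fine (P (A b)).
Proof. by rewrite /Rintegral integral_indic// setIT. Qed.

(** With the converse bound that follows, this is applied both to [S L] and to the identity under
    [normal_prob], passing from probabilities to smooth expectations and back. *)
Lemma probability_le_expectation (f : R -> R) (b e : R) : bounded_measurable f ->
  (forall x, 0 <= f x) -> 0 <= e -> (forall x, x <= b -> 1 - e <= f x) ->
  fine (P (X @^-1` `]-oo, b])) <= \int[P]_w f (X w) + e.
Proof.
move=> bf f0 e0 fb; rewrite -[leLHS]PE -[X in _ + X](Rintegral_cst_probability P).
have i1 : P.-integrable setT (fun w => (f (X w))%:E) := bounded_measurable_integrable P bf mX.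
have i2 : P.-integrable setT (fun w : T => e%:E) by exact: finite_measure_integrable_cst.
have i3 : P.-integrable setT (fun w => (\1_(A b) w)%:E) by exact: integrable_indic.
have i12 : P.-integrable setT (fun w => (f (X w) + e)%:E).
  by under eq_fun do rewrite EFinD; apply: integrableD.
rewrite -(RintegralD measurableT i1 i2); apply: (le_Rintegral measurableT i3 i12).
move=> w _; rewrite indicE; have [|_] := boolP (w \in A b).
  by rewrite inE /A /= in_itv/= => /fb; rewrite lerBlDr.
by rewrite /= addr_ge0.
Qed.

Lemma expectation_le_probability (f : R -> R) (b e : R) : bounded_measurable f ->
  (forall x, f x <= 1) -> 0 <= e -> (forall x, b <= x -> f x <= e) ->
  \int[P]_w f (X w) <= fine (P (X @^-1` `]-oo, b])) + e.
Proof.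
move=> bf f1 e0 fb; rewrite -[X in _ <= X + _]PE -[X in _ <= _ + X](Rintegral_cst_probability P).
have i1 : P.-integrable setT (fun w => (f (X w))%:E) := bounded_measurable_integrable P bf mX.
have i2 : P.-integrable setT (fun w : T => e%:E) by exact: finite_measure_integrable_cst.
have i3 : P.-integrable setT (fun w => (\1_(A b) w)%:E) by exact: integrable_indic.
have i32 : P.-integrable setT (fun w => (\1_(A b) w + e)%:E).
  by under eq_fun do rewrite EFinD; apply: integrableD.
rewrite -(RintegralD measurableT i3 i2); apply: (le_Rintegral measurableT i1 i32).
move=> w _; rewrite indicE; have [_|] := boolP (w \in A b).
  by rewrite (le_trans (f1 _))//= lerDl.
by rewrite notin_setE /A /= in_itv/= add0r => /negP; rewrite -ltNge => /ltW; exact: fb.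
Qed.

End tail_comparison.

(** A form of Slutsky's theorem: [Y] is compared with [S] only through inclusions of events, up to a
    shift of the threshold and an exceptional set, which is the information that squaring
    provides. *)
Lemma cvg_in_distribution_soft (d : nat -> measure_display)
    (T : forall L, measurableType (d L)) (P : forall L, probability (T L) R)
    (Y S : forall L, T L -> R) (s : R) :
  (forall L, measurable_fun setT (Y L)) -> (forall L, measurable_fun setT (S L)) ->
  (forall k m e : R, 0 < k -> 0 < e -> \forall L \near \oo,
     `|\int[P L]_w soft_step k m (S L w) - gauss_avg s (soft_step k m) 0| <= e) ->
  (forall t de e : R, 0 < de -> 0 < e -> \forall L \near \oo, exists B : set (T L),
     [/\ measurable B, (P L B <= e%:E)%E,
       Y L @^-1` `]-oo, t] `<=` S L @^-1` `]-oo, t + de] `|` B &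
       S L @^-1` `]-oo, t - de] `<=` Y L @^-1` `]-oo, t] `|` B]) ->
  cvg_in_distribution P Y (normal_prob 0 s).
Proof.
move=> mY mS Hclt Hsl; split=> // t ct.
pose Phi (x : R) : R := fine (normal_prob 0 s `]-oo, x]%classic).
have PhiE x : normal_prob 0 s `]-oo, x]%classic = (Phi x)%:E.
  by rewrite /Phi fineK// fin_num_measure.
pose pr L (A : set (T L)) : R := fine (P L A).
have prE L (A : set (T L)) : measurable A -> P L A = (pr L A)%:E.
  by move=> mA; rewrite /pr fineK// fin_num_measure.
have mpre L b (X : forall L, T L -> R) : (forall L, measurable_fun setT (X L)) ->
    measurable (X L @^-1` `]-oo, b]).
  by move=> mX; apply: measurable_preimage => //; exact: measurable_itv.
rewrite PhiE; apply/fine_cvgP; split.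
  by near=> L; rewrite fin_num_measure//; exact: mpre.
apply/(@cvgrPdist_le _ R^o) => e e0.
have cPhi : Phi x @[x --> t] --> Phi t.
  have : normal_prob 0 s `]-oo, x]%classic @[x --> t] --> (Phi t)%:E.
    by rewrite -PhiE; exact: ct.
  by move=> /fine_cvgP [].
(* Five losses: the exceptional set, the soft step for [S L], the smooth convergence, the soft step
   for the Gaussian, and continuity of [Phi] at [t]. *)
pose h := e / 5.
have h0 : 0 < h by rewrite divr_gt0.
move: cPhi => /(@cvgrPdist_le _ R^o) /(_ h h0) /nbhs_ballP [r /= r0 Hr].
(* The thresholds for [S L], the centres of the soft steps and the Gaussian thresholds sit at
   distances [de], [2 * de] and [3 * de] from [t], all below [r]. *)
pose de := r / 4.
have de0 : 0 < de by rewrite divr_gt0.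
have near_t x : `|t - x| < r -> `|Phi t - Phi x| <= h by move=> hx; exact: (Hr x).
have P1 : `|Phi t - Phi (t + 3 * de)| <= h.
  by apply: near_t; rewrite opprD addNKr normrN gtr0_norm /de; lra.
have P2 : `|Phi t - Phi (t - 3 * de)| <= h.
  by apply: near_t; rewrite opprB addrC subrK gtr0_norm /de; lra.
have [k1 k10 [u1 u2]] := @soft_step_approx R h de (t + 2 * de) h0 de0.
have [k2 k20 [l1 l2]] := @soft_step_approx R h de (t - 2 * de) h0 de0.
have b1 := smooth3_bounded_measurable (smooth3_soft_step (t + 2 * de) k10).
have b2 := smooth3_bounded_measurable (smooth3_soft_step (t - 2 * de) k20).
have midN : measurable_fun setT (id : measurableTypeR R -> R) by exact: measurable_id.
have gaussE f : gauss_avg s f 0 = \int[normal_prob 0 s]_y f y.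
  by rewrite /gauss_avg /avg; apply: eq_Rintegral => y _; rewrite add0r.
have G1 : gauss_avg s (soft_step k1 (t + 2 * de)) 0 <= Phi (t + 3 * de) + h.
  rewrite gaussE.
  have := @expectation_le_probability _ _ (normal_prob 0 s) id midN _ (t + 3 * de) h b1.
  apply => [x||x hx]; [exact: soft_step_le1|exact: ltW|].
  by apply: u2; clear -hx; lra.
have G2 : Phi (t - 3 * de) <= gauss_avg s (soft_step k2 (t - 2 * de)) 0 + h.
  rewrite gaussE.
  have := @probability_le_expectation _ _ (normal_prob 0 s) id midN _ (t - 3 * de) h b2.
  apply => [x||x hx]; [exact: soft_step_ge0|exact: ltW|].
  by apply: l1; clear -hx; lra.
have H1 := Hclt k1 (t + 2 * de) h k10 h0.
have H2 := Hclt k2 (t - 2 * de) h k20 h0.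
have H3 := Hsl t de h de0 h0.
apply: filterS3 H1 H2 H3 => L C1 C2 [B [mB PB sub1 sub2]].
have sub_le (A C : set (T L)) : measurable A -> measurable C -> A `<=` C `|` B ->
    pr L A <= pr L C + h.
  move=> mA mC AC; rewrite -lee_fin EFinD -!prE//.
  apply: (@le_trans _ _ (P L (C `|` B))).
    by apply: le_measure => //; rewrite inE//; exact: measurableU.
  by rewrite (le_trans (measureU2 _ mC mB))// leeD2l.
have Q1 := sub_le _ _ (mpre L t Y mY) (mpre L (t + de) S mS) sub1.
have Q2 := sub_le _ _ (mpre L (t - de) S mS) (mpre L t Y mY) sub2.
have S1 : pr L (S L @^-1` `]-oo, t + de]) <=
    \int[P L]_w soft_step k1 (t + 2 * de) (S L w) + h.
  have := @probability_le_expectation _ _ (P L) (S L) (mS L) _ (t + de) h b1.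
  apply => [x||x hx]; [exact: soft_step_ge0|exact: ltW|].
  by apply: u1; clear -hx; lra.
have S2 : \int[P L]_w soft_step k2 (t - 2 * de) (S L w) <=
    pr L (S L @^-1` `]-oo, t - de]) + h.
  have := @expectation_le_probability _ _ (P L) (S L) (mS L) _ (t - de) h b2.
  apply => [x||x hx]; [exact: soft_step_le1|exact: ltW|].
  by apply: l2; clear -hx; lra.
rewrite /= -/(pr L _); move: P1 P2 G1 G2 C1 C2 Q1 Q2 S1 S2.
have -> : e = 5 * h by rewrite /h mulrC divfK.
move: (pr L _) (pr L _) (pr L _) (\int[_]_w _) (\int[_]_w _) (gauss_avg _ _ _) (gauss_avg _ _ _)
  (Phi _) (Phi _) (Phi t) => p1 p2 p3 i1 i2 g1 g2 f1 f2 f3.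
rewrite !ler_norml => /andP[? ?] /andP[? ?] ? ? /andP[? ?] /andP[? ?] ? ? ? ?.
by apply/andP; split; lra.
Unshelve. all: by end_near.
Qed.

End slutsky.

(** * The two estimators *)

Section estimator_identities.
Context {R : realType}.

Lemma sum_sqr_deviations (L : nat) (z : 'I_L -> R) : (0 < L)%N ->
  \sum_(l < L) (z l - sample_mean z) ^+ 2 =
  \sum_(l < L) z l ^+ 2 - (\sum_(l < L) z l) ^+ 2 / L%:R.
Proof.
move=> L0; have L0' : L%:R != 0 :> R by rewrite pnatr_eq0 -lt0n.
under eq_bigr do rewrite sqrrB.
rewrite big_split /= sumrB sumr_const card_ord.
have -> : \sum_(l < L) z l * sample_mean z *+ 2 = 2 * (\sum_(l < L) z l) * sample_mean z.
  by rewrite mulr_sumr mulr_suml; apply: eq_bigr => l _; rewrite -mulr_natl mulrA.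
by rewrite /sample_mean -mulr_natl; field.
Qed.

Lemma sigmasq_hat1_standardized (c L : nat) (s : R) (x : 'I_L -> R) :
  (0 < c)%N -> (0 < L)%N -> s != 0 ->
  sigmasq_hat1 c x = s * (1 + (\sum_(l < L) (x l / s - c%:R)) / (c%:R * L%:R)).
Proof.
move=> c0 L0 s0; have L0' : L%:R != 0 :> R by rewrite pnatr_eq0 -lt0n.
have c0' : c%:R != 0 :> R by rewrite pnatr_eq0 -lt0n.
rewrite sumrB -mulr_suml sumr_const card_ord -mulr_natr /sigmasq_hat1.
by field; rewrite s0 L0' c0'.
Qed.

Lemma sigmasq_hat2_standardized (c L : nat) (s : R) (z : 'I_L -> R) :
  (0 < L)%N -> 0 < s ->
  sigmasq_hat2 c z = s * Num.sqrt ((\sum_(l < L) (z l / s - c%:R) ^+ 2 -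
    (\sum_(l < L) (z l / s - c%:R)) ^+ 2 / L%:R) / (2 * c%:R * L%:R)).
Proof.
move=> L0 s0; have L0' : L%:R != 0 :> R by rewrite pnatr_eq0 -lt0n.
rewrite -sum_sqr_deviations// -[s in s * _]gtr0_norm// -sqrtr_sqr -sqrtrM ?sqr_ge0//.
congr (Num.sqrt _); rewrite mulrA; congr (_ / _).
rewrite mulr_sumr; apply: eq_bigr => l _; rewrite -exprMn; congr (_ ^+ 2).
rewrite /sample_mean sumrB -mulr_suml sumr_const card_ord -mulr_natr.
by field; rewrite L0' gt_eqF.
Qed.

(* With B the standardized first estimator, the ratio is at most 1 + t / (N a)
   iff the square of the second one is at most (B (1 + t / (N a)))^2, which is
   affine in the data up to a remainder bounded independently of N. *)
Lemma ratio_statistic_le (C N a t u v q : R) :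
  0 < C -> 0 < N -> 0 < a -> a ^+ 2 = C / 2 ->
  0 < 1 + v / (C * N) -> 0 <= 1 + t / a / N -> 0 <= q - u ^+ 2 ->
  (N * a * (Num.sqrt ((q - u ^+ 2) / (2 * C * N ^+ 2)) / (1 + v / (C * N)) - 1) <= t) =
  (q - 2 * C * N ^+ 2 - 4 * (v * N) <= 8 * a * N * t +
     (u ^+ 2 + 4 * (t / a) * v + 2 * C * (t / a + v / C + t / a * v / (C * N)) ^+ 2)).
Proof.
move=> C0 N0 a0 aE B0 r0 q0; set B := 1 + v / (C * N) in B0 *.
set r := 1 + t / a / N in r0 *.
have [Cn Nn an] : [/\ C != 0, N != 0 & a != 0] by rewrite !gt_eqF.
have D0 : 0 < 2 * C * N ^+ 2 by rewrite !mulr_gt0// exprn_gt0.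
rewrite -ler_pdivlMl ?mulr_gt0// lerBlDl ler_pdivrMr//.
have -> : 1 + (N * a)^-1 * t = r by rewrite /r; field; rewrite an Nn.
have B0' := ltW B0; have D0' := ltW D0.
rewrite -ler_sqr ?nnegrE ?sqrtr_ge0 ?mulr_ge0//.
rewrite sqr_sqrtr ?divr_ge0// ler_pdivrMr//.
rewrite -subr_ge0 -[RHS]subr_ge0; congr (0 <= _).
(* With [t / a] as the variable, [a] occurs elsewhere only as a square, which [aE] eliminates; the
   rest is a rational identity. *)
have -> : 8 * a * N * t = 8 * a ^+ 2 * N * (t / a) by field.
by rewrite aE /r /B; field; rewrite an Nn Cn.
Qed.

(** Triangle inequality term by term; [1 <= N] removes [N] from the last denominator, so the bound
    is uniform in the sample size. *)
Lemma ratio_remainder_le (C N s u v K : R) : 0 < C -> 1 <= N ->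
  `|u| <= K -> `|v| <= K ->
  `|u ^+ 2 + 4 * s * v + 2 * C * (s + v / C + s * v / (C * N)) ^+ 2| <=
  K ^+ 2 + 4 * `|s| * K + 2 * C * (`|s| + K / C + `|s| * K / C) ^+ 2.
Proof.
move=> C0 N1 uK vK; have N0 : 0 < N by apply: lt_le_trans N1.
have sq (x y : R) : `|x| <= y -> `|x ^+ 2| <= y ^+ 2.
  by move=> xy; rewrite normrX lerXn2r// nnegrE// (le_trans _ xy).
apply: (le_trans (ler_normD _ _)); apply: lerD.
  apply: (le_trans (ler_normD _ _)); apply: lerD; first exact: sq.
  by rewrite !normrM (gtr0_norm (_ : 0 < 4))// ler_wpM2l// mulr_ge0.
rewrite normrM (gtr0_norm (_ : 0 < 2 * C)) ?mulr_gt0//.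
apply: ler_wpM2l; [by rewrite mulr_ge0// ltW|apply: sq].
apply: (le_trans (ler_normD _ _)); apply: lerD.
  apply: (le_trans (ler_normD _ _)); rewrite lerD2l normrM (gtr0_norm (_ : 0 < C^-1)) ?invr_gt0//.
  by rewrite ler_wpM2r// invr_ge0 ltW.
rewrite 2!normrM (gtr0_norm (_ : 0 < (C * N)^-1)) ?invr_gt0 ?mulr_gt0//.
apply: ler_pM; [by rewrite mulr_ge0|by rewrite invr_ge0 mulr_ge0// ltW|by rewrite ler_wpM2l|].
by rewrite lef_pV2 ?posrE ?mulr_gt0// ler_peMr// ltW.
Qed.

End estimator_identities.

(** The inverse is x times a real power of x^2, and real powers are measurable on the whole line; at
    0 both expressions are 0. *)
Lemma measurable_invr (R : realType) : measurable_fun setT (fun x : R => x^-1).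
Proof.
have -> : (fun x : R => x^-1) = (fun x => x * (x ^+ 2) `^ (- 1)).
  apply/funext => x; rewrite powR_inv1 ?sqr_ge0//.
  have [->|x0] := eqVneq x 0; first by rewrite mul0r invr0.
  by rewrite expr2 invfM mulVKf.
apply: measurable_funM; first exact: measurable_id.
exact: (measurableT_comp (measurable_powR _) (exprn_measurable _)).
Qed.

Lemma measurable_ratio_statistic d (T : measurableType d) (R : realType)
    (P : probability T R) (c L : nat) (Z X : 'I_L -> {RV P >-> R}) (k : R) :
  measurable_fun setT (fun w => k *
    (sigmasq_hat2 c (fun l => Z l w) / sigmasq_hat1 c (fun l => X l w) - 1)).
Proof.
apply: measurable_funM => //; apply: measurable_funB => //.
have ms (Y : 'I_L -> T -> R) : (forall l, measurable_fun setT (Y l)) ->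
  measurable_fun setT (fun w => \sum_(l < L) Y l w) by move=> mY; exact: measurable_sum.
apply: measurable_funM; last first.
  apply: (measurableT_comp (@measurable_invr R)); apply: measurable_funM => //.
  by apply: (ms _) => l; exact: measurable_funPT.
apply: (measurableT_comp (continuous_measurable_fun (@sqrt_continuous R))).
apply: measurable_funM => //; apply: (ms _) => l; apply: measurable_funX.
apply: measurable_funB; first exact: measurable_funPT.
apply: measurable_funM => //; apply: (ms _) => j; exact: measurable_funPT.
Qed.

Lemma second_moment_tail d (T : measurableType d) (R : realType) (P : probability T R)
    (W : T -> R) (v K : R) : measurable_fun setT W -> 0 < K ->
  (\int[P]_w (W w ^+ 2)%:E = v%:E)%E ->
  (P [set w | (K < `|W w|)%R] <= (v / K ^+ 2)%:E)%E.
Proof.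
move=> mW K0 E2; set A := [set w | _].
have mA : measurable A.
  have -> : A = (fun w => `|W w|) @^-1` `]K, +oo[.
    by apply/seteqP; split=> w /=; rewrite in_itv/= andbT.
  apply: measurable_preimage; last exact: measurable_itv.
  exact: (measurableT_comp (@normr_measurable R setT)).
have mW2 : measurable_fun setT (fun w => (W w ^+ 2)%:E).
  by apply/measurable_EFinP; exact: measurable_funX.
rewrite mulrC EFinM lee_pdivlMl ?exprn_gt0// -E2.
rewrite -integral_cst//.
apply: (@le_trans _ _ (\int[P]_(w in A) (W w ^+ 2)%:E)%E).
  apply: ge0_le_integral => //.
  - by move=> w _; rewrite lee_fin sqr_ge0.
  - exact: measurable_funTS.
  - move=> w /= /ltW Kw; rewrite lee_fin -[W w ^+ 2]real_normK ?num_real//.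
    by rewrite lerXn2r// nnegrE// ltW.
by apply: ge0_subset_integral => // w _; rewrite lee_fin sqr_ge0.
Qed.

Lemma moments3Z d (T : measurableType d) (R : realType) (P : probability T R)
    (xi : T -> R) (k v rho : R) : moments3 P xi v rho ->
  moments3 P (fun w => k * xi w) (k ^+ 2 * v) (`|k| ^+ 3 * rho).
Proof.
move=> [i1 i2 i3 [e1 e2 e3]].
have i1' : P.-integrable setT (fun w => (k * xi w)%:E).
  by under eq_fun do rewrite EFinM; exact: integrableZl.
have i2' : P.-integrable setT (fun w => ((k * xi w) ^+ 2)%:E).
  by under eq_fun do rewrite exprMn EFinM; exact: integrableZl.
have i3' : P.-integrable setT (fun w => (`|k * xi w| ^+ 3)%:E).
  by under eq_fun do rewrite normrM exprMn EFinM; exact: integrableZl.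
split=> //; split.
- by rewrite (RintegralZl _ measurableT i1) e1 mulr0.
- under eq_Rintegral do rewrite exprMn.
  by rewrite (RintegralZl _ measurableT i2) e2.
- under eq_Rintegral do rewrite normrM exprMn.
  by rewrite (RintegralZl _ measurableT i3) ler_wpM2l// exprn_ge0.
Qed.

(** * Central limit bound and tail bound for the standardized sample *)

Section standardized_sample.
Context {R : realType} (c : nat) (c0 : (0 < c)%N).
Local Notation C := (c%:R : R).

Let r1 : {poly R} := ('X - C%:P) ^+ 2 - (2 * C)%:P.
Let r2 : {poly R} := 'X - C%:P.
Let rho (r : {poly R}) := \sum_(i < size (1 + r ^+ 4)) (1 + r ^+ 4)`_i * chi2_moment c i.

(** Third-moment cost of replacing one Z term and one X term, before scaling: a bound for the
    variable plus one for its Gaussian substitute. It depends on [c] alone. *)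
Definition clt_const : R := (rho r1 + 2 * Num.sqrt (8 * C ^+ 2 + 48 * C) ^+ 3) +
  (`|- 4| ^+ 3 * rho r2 + 2 * Num.sqrt (32 * C) ^+ 3).

Context (s : R) d (T : measurableType d) (P : probability T R) (L : nat).
Context (Z X : 'I_L -> {RV P >-> R}).
Hypothesis ind : mutually_independent (joint_family Z X).
Hypothesis lawZ : forall l, has_law P (fun w => Z l w / s) (chi2_prob c).
Hypothesis lawX : forall l, has_law P (fun w => X l w / s) (chi2_prob c).

Definition clt_sum (w : T) : R := \sum_(l < L) ((Z l w / s - C) ^+ 2 - 2 * C)
  - 4 * \sum_(l < L) (X l w / s - C).

Let I := ('I_L + 'I_L)%type.
Let term (h : R) (i : I) (y : R) : R := h * match i with
  | inl _ => (y / s - C) ^+ 2 - 2 * C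
  | inr _ => - 4 * (y / s - C)
  end.
Let variance (i : I) : R := match i with inl _ => 8 * C ^+ 2 + 48 * C | inr _ => 32 * C end.
Let third (i : I) : R := match i with inl _ => rho r1 | inr _ => `|- 4| ^+ 3 * rho r2 end.

Let mstd : measurable_fun setT (fun y : R => y / s - C).
Proof. by apply: measurable_funB => //; exact: measurable_funM. Qed.

Let mRV (Y : {RV P >-> R}) : measurable_fun setT (fun w => Y w / s).
Proof. by apply: measurable_funM => //; exact: measurable_funPT. Qed.

Let mterm h i : measurable_fun setT (term h i).
Proof.
apply: measurable_funM => //; case: i => l; last exact: measurable_funM.
by apply: measurable_funB => //; exact: measurable_funX.
Qed.

Let moments_term h i :
  moments3 P (fun w => term h i (joint_family Z X i w)) (h ^+ 2 * variance i) (`|h| ^+ 3 * third i).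
Proof.
apply: moments3Z; case: i => l /=.
  have E x : (x - C) ^+ 2 - 2 * C = r1.[x] by rewrite /r1 !hornerE.
  have [e1 e2] := chi2_centered_sqr c0 (mRV (Z l)) (@lawZ l).
  under eq_fun do rewrite E; apply: (moments3_poly c0 (mRV (Z l)) (@lawZ l)).
    by under eq_Rintegral do rewrite -E.
  by under eq_Rintegral do rewrite -E.
have E x : x - C = r2.[x] by rewrite /r2 !hornerE.
have [e1 e2] := chi2_centered c0 (mRV (X l)) (@lawX l).
have -> : 32 * C = (- 4) ^+ 2 * (2 * C) by ring.
apply: moments3Z; under eq_fun do rewrite E; apply: (moments3_poly c0 (mRV (X l)) (@lawX l)).
  by under eq_Rintegral do rewrite -E.
by under eq_Rintegral do rewrite -E.
Qed.

Let sum_cases (F : I -> R) (a b : R) : (forall l, F (inl l) = a) -> (forall l, F (inr l) = b) ->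
  \sum_(i <- index_enum I) F i = L%:R * (a + b).
Proof.
move=> Fa Fb; rewrite big_sumType /= (eq_bigr (fun=> a))// [X in _ + X](eq_bigr (fun=> b))//.
by rewrite !sumr_const card_ord -[a *+ L]mulr_natl -[b *+ L]mulr_natl mulrDr.
Qed.

(** Each of the [L] pairs has variance h^2 (8 c^2 + 48 c + 32 c) and cost h^3 [clt_const]. With h of
    order 1 / sqrt L the variance stays fixed and the error vanishes. *)
Lemma clt_bound (M h : R) f : (0 < L)%N -> 0 < h -> 0 <= M -> smooth3 M f ->
  (forall x, 0 <= f x) ->
  `|\int[P]_w f (h * clt_sum w)
     - gauss_avg (Num.sqrt (h ^+ 2 * L%:R * (8 * C ^+ 2 + 80 * C))) f 0| <=
  M * (h ^+ 3 * L%:R * clt_const).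
Proof.
move=> L0 h0 M0 sf f0; have C0 : 0 < C by rewrite ltr0n.
have var0 i : 0 < variance i by case: i => l; rewrite ?addr_gt0 ?mulr_gt0 ?exprn_gt0.
have hv0 i : 0 < h ^+ 2 * variance i by rewrite mulr_gt0 ?exprn_gt0.
have ne : index_enum I != [::].
  apply/eqP => e; have := mem_index_enum (inl (Ordinal L0) : I); by rewrite e.
have := lindeberg_bound ind (mterm h) M0 sf f0 (index_enum_uniq I) ne hv0 (moments_term h).
have -> : \sum_(i <- index_enum I) h ^+ 2 * variance i = h ^+ 2 * L%:R * (8 * C ^+ 2 + 80 * C).
  rewrite (sum_cases (a := h ^+ 2 * (8 * C ^+ 2 + 48 * C)) (b := h ^+ 2 * (32 * C)))//.
  by rewrite -mulrDr mulrCA mulrA; congr (_ * _); ring.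
have sumE w : \sum_(i <- index_enum I) term h i (joint_family Z X i w) = h * clt_sum w.
  rewrite big_sumType /= /clt_sum mulrBr !mulr_sumr -sumrN; congr (_ + _).
  by apply: eq_bigr => l _; rewrite /term /=; move: (X l w / s - C) => y; ring.
under eq_Rintegral do rewrite sumE.
move=> /le_trans; apply; apply: ler_wpM2l => //.
have sq (v : R) : Num.sqrt (h ^+ 2 * v) = h * Num.sqrt v.
  by rewrite sqrtrM ?sqr_ge0// sqrtr_sqr gtr0_norm.
rewrite (sum_cases (a := h ^+ 3 * (rho r1 + 2 * Num.sqrt (8 * C ^+ 2 + 48 * C) ^+ 3))
  (b := h ^+ 3 * (`|- 4| ^+ 3 * rho r2 + 2 * Num.sqrt (32 * C) ^+ 3))) /clt_const; last 2 first.
- by move=> l; rewrite sq exprMn (gtr0_norm h0) /variance /third; ring.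
- by move=> l; rewrite sq exprMn (gtr0_norm h0) /variance /third; ring.
move: (rho r1) (rho r2) (Num.sqrt _) (Num.sqrt _) (`|_|) => p1 p2 q1 q2 n4.
by rewrite le_eqVlt; apply/orP; left; apply/eqP; ring.
Qed.

(** The injection [j] selects half of the joint family, [inl] for [Z] and [inr] for [X], so that one
    Chebyshev bound serves both sums. *)
Lemma clt_tail (Y : 'I_L -> {RV P >-> R}) (K : R) :
  (exists2 j : 'I_L -> I, injective j & forall l, joint_family Z X (j l) = Y l) ->
  (forall l, has_law P (fun w => Y l w / s) (chi2_prob c)) -> 0 < K ->
  (P [set w | (K < `|\sum_(l < L) (Y l w / s - C)|)%R] <= (2 * C * L%:R / K ^+ 2)%:E)%E.
Proof.
move=> [j j_inj YE] lawY K0.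
have mS : measurable_fun setT (fun w => \sum_(l < L) (Y l w / s - C)).
  apply: measurable_sum => l; exact: (measurableT_comp mstd (measurable_funPT (Y l))).
have law i : has_law P (fun w => joint_family Z X i w / s) (chi2_prob c) by case: i.
have ms i : moments3 P (fun w => joint_family Z X i w / s - C) (2 * C) (rho r2).
  have E x : x - C = r2.[x] by rewrite /r2 !hornerE.
  have [e1 e2] := chi2_centered c0 (mRV _) (law i).
  under eq_fun do rewrite E; apply: (moments3_poly c0 (mRV _) (law i)).
    by under eq_Rintegral do rewrite -E.
  by under eq_Rintegral do rewrite -E.
apply: second_moment_tail => //.
have := @second_moment_indep_sum _ _ _ P _ (joint_family Z X) (fun _ y => y / s - C) ind
  (fun _ => mstd) [seq j l | l <- index_enum 'I_L] (fun _ => 2 * C).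
rewrite map_inj_uniq ?index_enum_uniq// => /(_ isT).
under eq_integral do rewrite big_map; rewrite big_map sumr_const card_ord -[_ *+ L]mulr_natr.
under eq_integral do under eq_bigr do rewrite YE.
by apply => i; have [? ? ? []] := ms i.
Qed.

End standardized_sample.

(** A deterministic statement. [K < c%:R * N] keeps the first estimator positive and the bound on
    [t / a] keeps the threshold for the ratio nonnegative, as squaring requires; [E] is the uniform
    bound on the remainder. *)
Lemma statistic_clt_sum_le (R : realType) (c L : nat) (s : R) (z x : 'I_L -> R) (a t K : R) :
  (0 < c)%N -> (0 < L)%N -> 0 < s -> a = Num.sqrt (c%:R / 2) ->
  let N : R := Num.sqrt L%:R in
  let S : R := (8 * a * N)^-1 * (\sum_(l < L) ((z l / s - c%:R) ^+ 2 - 2 * c%:R)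
     - 4 * \sum_(l < L) (x l / s - c%:R)) in
  let E : R := K ^+ 2 + 4 * `|t / a| * K +
     2 * c%:R * (`|t / a| + K / c%:R + `|t / a| * K / c%:R) ^+ 2 in
  let Y : R := Num.sqrt (c%:R * L%:R / 2) * (sigmasq_hat2 c z / sigmasq_hat1 c x - 1) in
  K < c%:R * N -> `|t / a| <= N ->
  `|\sum_(l < L) (z l / s - c%:R)| <= K * N -> `|\sum_(l < L) (x l / s - c%:R)| <= K * N ->
  (Y <= t -> S <= t + (8 * a * N)^-1 * E) /\ (S <= t - (8 * a * N)^-1 * E -> Y <= t).
Proof.
move=> c0 L0 s0 aE N S E Y KN tN.
have C0 : 0 < c%:R :> R by rewrite ltr0n.
have L0' : 0 < L%:R :> R by rewrite ltr0n.
have N0 : 0 < N by rewrite sqrtr_gt0.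
have NE : N ^+ 2 = L%:R by rewrite sqr_sqrtr// ltW.
have a0 : 0 < a by rewrite aE sqrtr_gt0 divr_gt0.
have aE2 : a ^+ 2 = c%:R / 2 by rewrite aE sqr_sqrtr// divr_ge0.
have N1 : 1 <= N by rewrite -[1]sqrtr1 ler_sqrt// ler1n.
rewrite {}/Y (sigmasq_hat1_standardized x c0 L0 (lt0r_neq0 s0))
  (sigmasq_hat2_standardized c z L0 s0).
set SU := \sum_(l < L) (z l / s - c%:R); set SV := \sum_(l < L) (x l / s - c%:R).
set SQ := \sum_(l < L) (z l / s - c%:R) ^+ 2.
move=> hU hV.
have uK : `|SU / N| <= K by rewrite normrM (gtr0_norm (_ : 0 < N^-1)) ?invr_gt0// ler_pdivrMr.
have vK : `|SV / N| <= K by rewrite normrM (gtr0_norm (_ : 0 < N^-1)) ?invr_gt0// ler_pdivrMr.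
have [Nn Cn an] : [/\ N != 0, c%:R != 0 :> R & a != 0] by rewrite !gt_eqF.
have SE : S = (8 * a * N)^-1 * (SQ - 2 * c%:R * N ^+ 2 - 4 * (SV / N * N)).
  rewrite /S divfK// NE sumrB sumr_const card_ord; congr (_ * (_ - _ - _)).
  by rewrite -[_ *+ L]mulr_natr.
have B0 : 0 < 1 + SV / N / (c%:R * N).
  rewrite -[X in X < _](subrr 1) ltrD2l -[ltRHS]opprK ltrN2 -mulNr ltr_pdivrMr ?mulr_gt0// mul1r.
  by apply: le_lt_trans KN; apply: le_trans vK; rewrite -normrN ler_norm.
have r0 : 0 <= 1 + t / a / N.
  rewrite -[X in X <= _](subrr 1) lerD2l -[leRHS]opprK lerN2 -mulNr ler_pdivrMr// mul1r.
  by apply: le_trans tN; rewrite -normrN ler_norm.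
have q0 : 0 <= SQ - (SU / N) ^+ 2.
  rewrite expr_div_n NE -sum_sqr_deviations//.
  by apply: sumr_ge0 => l _; exact: sqr_ge0.
have key := @ratio_statistic_le R c%:R N a t (SU / N) (SV / N) SQ C0 N0 a0 aE2 B0 r0 q0.
have rem := @ratio_remainder_le R c%:R N (t / a) (SU / N) (SV / N) K C0 N1 uK vK.
have YE : Num.sqrt (c%:R * L%:R / 2) *
    (s * Num.sqrt ((SQ - SU ^+ 2 / L%:R) / (2 * c%:R * L%:R)) / (s * (1 + SV / (c%:R * L%:R))) - 1)
  = N * a * (Num.sqrt ((SQ - (SU / N) ^+ 2) / (2 * c%:R * N ^+ 2)) / (1 + SV / N / (c%:R * N)) - 1).
  have -> : Num.sqrt (c%:R * L%:R / 2) = N * a.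
    by rewrite aE /N -sqrtrM ?ler0n//; congr Num.sqrt; ring.
  rewrite -mulf_div divff ?gt_eqF// mul1r expr_div_n NE; congr (_ * (_ / (1 + _) - 1)).
  by rewrite -NE; field; rewrite Nn Cn.
rewrite YE key SE; move: rem; rewrite -/E.
set e := (_ + _ + _ * _ ^+ 2).
set D := SQ - _ - _; rewrite ler_norml => /andP[e1 e2].
have h0 : 0 < 8 * a * N by rewrite !mulr_gt0.
by split; rewrite !ler_pdivrMl// !(mulrDr, mulrN, mulVKf)// ?gt_eqF//; lra.
Qed.

Theorem proposition2 (R : realType) (c : nat) (sigma2 : R)
    (d : nat -> measure_display) (T : forall L, measurableType (d L))
    (P : forall L, probability (T L) R)
    (Z X : forall L, 'I_L -> {RV (P L) >-> R})
    (c_gt0 : (0 < c)%N) (sigma2_gt0 : 0 < sigma2)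
    (ZX_iid : forall L, iid (joint_family (Z L) (X L)))
    (Z_chi2 : forall L (l : 'I_L),
      has_law (P L) (fun w => Z L l w / sigma2) (chi2_prob c))
    (X_chi2 : forall L (l : 'I_L),
      has_law (P L) (fun w => X L l w / sigma2) (chi2_prob c)) :
  cvg_in_distribution P
    (fun L w => Num.sqrt (c%:R * L%:R / 2) *
       (sigmasq_hat2 c (fun l => Z L l w) / sigmasq_hat1 c (fun l => X L l w)
        - 1))
    (normal_law 0 ((c%:R + 10) / 4)).
Proof.
have C0 : 0 < c%:R :> R by rewrite ltr0n.
pose a : R := Num.sqrt (c%:R / 2); pose N L : R := Num.sqrt L%:R.
have a0 : 0 < a by rewrite sqrtr_gt0 divr_gt0.
have aE : a ^+ 2 = c%:R / 2 by rewrite sqr_sqrtr// divr_ge0.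
have NE L : N L ^+ 2 = L%:R by rewrite sqr_sqrtr.
(* As a = sqrt (c / 2), the factor 8 a is 4 sqrt (2 c). *)
pose S L w := (8 * a * N L)^-1 * clt_sum c sigma2 (Z L) (X L) w.
have large r : \forall L \near \oo, (0 < L)%N /\ r <= N L.
  near=> L; split; first by near: L; exact: nbhs_infty_gt.
  have [r0|r0] := leP r 0; first by rewrite (le_trans r0)// sqrtr_ge0.
  rewrite -[r]gtr0_norm// -sqrtr_sqr ler_sqrt ?ler0n//.
  by near: L; exact: nbhs_infty_ger.
apply: (@cvg_in_distribution_soft _ _ _ _ _ S).
- by move=> L; exact: measurable_ratio_statistic.
- move=> L; apply: measurable_funM => //; apply: measurable_funB.
    apply: measurable_sum => l; apply: measurable_funB => //; apply: measurable_funX.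
    apply: measurable_funB => //; apply: measurable_funM => //; exact: measurable_funPT.
  apply: measurable_funM => //; apply: measurable_sum => l.
  apply: measurable_funB => //; apply: measurable_funM => //; exact: measurable_funPT.
- move=> k m e k0 e0.
  pose D := k ^+ 3 * (((8 * a) ^- 3) * clt_const c).
  have := large (D / e); apply: filterS => L [L0 DL].
  have N0 : 0 < N L by rewrite sqrtr_gt0 ltr0n.
  have h0 : 0 < (8 * a * N L)^-1 by rewrite invr_gt0 !mulr_gt0.
  have := @clt_bound R c c_gt0 sigma2 _ _ (P L) L (Z L) (X L) (ZX_iid L).1 (Z_chi2 L) (X_chi2 L)
    (k ^+ 3) (8 * a * N L)^-1 (soft_step k m) L0 h0 (exprn_ge0 3 (ltW k0)) (smooth3_soft_step m k0)
    (soft_step_ge0 k m).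
  have -> : (8 * a * N L)^-1 ^+ 2 * L%:R * (8 * c%:R ^+ 2 + 80 * c%:R) = (c%:R + 10) / 4.
    rewrite exprVn !exprMn NE aE; field.
    by rewrite !gt_eqF// ltr0n.
  move=> /le_trans; apply.
  have -> : k ^+ 3 * ((8 * a * N L)^-1 ^+ 3 * L%:R * clt_const c) = D / N L.
    by rewrite -(NE L) /D; field; rewrite !gt_eqF.
  by rewrite ler_pdivrMr// mulrC -ler_pdivrMr.
- move=> t de e de0 e0.
  (* Chebyshev gives 2 c / K^2 for each sum, at most e / 2 because K >= 1 and (e / 2) K = e / 2 + 2
     c. *)
  pose K := 1 + 4 * c%:R / e.
  have K1 : 1 <= K by rewrite lerDl divr_ge0 ?mulr_ge0// ltW.
  have K0 : 0 < K by exact: lt_le_trans K1.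
  pose E := K ^+ 2 + 4 * `|t / a| * K +
     2 * c%:R * (`|t / a| + K / c%:R + `|t / a| * K / c%:R) ^+ 2.
  (* These make the first estimator positive on the good event and the ratio threshold nonnegative;
     [H3] brings the remainder, divided by 8 a sqrt L, below [de]. *)
  have H1 := large (K / c%:R + 1); have H2 := large `|t / a|.
  have H3 := large (E / (8 * a * de)).
  apply: filterS3 H1 H2 H3 => L [L0 hK] [_ ht] [_ hE].
  have N0 : 0 < N L by rewrite sqrtr_gt0 ltr0n.
  have NK0 : 0 < K * N L by rewrite mulr_gt0.
  pose W (Y : 'I_L -> {RV (P L) >-> R}) w := \sum_(l < L) (Y l w / sigma2 - c%:R).
  pose B (Y : 'I_L -> {RV (P L) >-> R}) := [set w | (K * N L < `|W Y w|)%R].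
  have mW Y : measurable_fun setT (W Y).
    apply: measurable_sum => l; apply: measurable_funB => //.
    apply: measurable_funM => //; exact: measurable_funPT.
  have mB Y : measurable (B Y).
    have -> : B Y = (fun w => `|W Y w|) @^-1` `]K * N L, +oo[.
      by apply/seteqP; split=> w /=; rewrite in_itv/= andbT.
    apply: measurable_preimage; last exact: measurable_itv.
    exact: (measurableT_comp (@normr_measurable R setT)).
  have tail Y : (P L (B Y) <= (2 * c%:R * L%:R / (K * N L) ^+ 2)%:E)%E ->
    (P L (B Y) <= (e / 2)%:E)%E.
    move=> /le_trans; apply; rewrite lee_fin exprMn NE.
    have -> : 2 * c%:R * L%:R / (K ^+ 2 * L%:R) = 2 * c%:R / K ^+ 2.
      by field; rewrite !gt_eqF ?ltr0n.
    rewrite ler_pdivrMr ?exprn_gt0//; apply: (@le_trans _ _ (e / 2 * K)).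
      have -> : e / 2 * K = e / 2 + 2 * c%:R by rewrite /K; field; rewrite gt_eqF.
      by rewrite lerDr divr_ge0// ltW.
    by rewrite ler_wpM2l ?divr_ge0 ?(ltW e0)// expr2 ler_peMl// ltW.
  have cmp w : ~ (B (Z L) `|` B (X L)) w ->
    (Num.sqrt (c%:R * L%:R / 2) * (sigmasq_hat2 c (fun l => Z L l w) /
       sigmasq_hat1 c (fun l => X L l w) - 1) <= t -> S L w <= t + de) /\
    (S L w <= t - de -> Num.sqrt (c%:R * L%:R / 2) * (sigmasq_hat2 c (fun l => Z L l w) /
       sigmasq_hat1 c (fun l => X L l w) - 1) <= t).
    move=> /not_orP [/negP wZ /negP wX]; move: wZ wX; rewrite -!leNgt => wZ wX.
    have KN : K < c%:R * N L by rewrite mulrC -ltr_pdivrMr//; apply: lt_le_trans hK; rewrite ltrDl.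
    have Ede : (8 * a * N L)^-1 * E <= de.
      rewrite ler_pdivrMl ?mulr_gt0//; move: hE.
      by rewrite ler_pdivrMr ?mulr_gt0//; congr (_ <= _); ring.
    have [h1 h2] := @statistic_clt_sum_le R c L sigma2 (fun l => Z L l w) (fun l => X L l w)
      a t K c_gt0 L0 sigma2_gt0 erefl KN ht wZ wX.
    split=> [/h1 h|h].
      by apply: (le_trans h); rewrite lerD2l.
    by apply: h2; apply: (le_trans h); rewrite lerD2l lerN2.
  exists (B (Z L) `|` B (X L)); split; first exact: measurableU.
  + apply: (le_trans (measureU2 _ (mB _) (mB _))).
    have -> : e%:E = ((e / 2)%:E + (e / 2)%:E)%E by rewrite -EFinD -splitr.
    apply: leeD; apply: tail; apply: (clt_tail c_gt0 (ZX_iid L).1) => //.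
    * by exists inl => // l1 l2 [].
    * by exists inr => // l1 l2 [].
  + move=> w; have [wB|/cmp [h _]] := pselect ((B (Z L) `|` B (X L)) w); first by right.
    by rewrite /= !in_itv/= => /h; left.
  + move=> w; have [wB|/cmp [_ h]] := pselect ((B (Z L) `|` B (X L)) w); first by right.
    by rewrite /= !in_itv/= => /h; left.
Unshelve. all: by end_near.
Qed.
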